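(* Let $\mathsf{H}$ be a right quaternionic Hilbert space, let $p\in[\frac12,1)$, and let $T\in\mathfrak{B}(\mathsf{H})$ be a $p$-hyponormal operator with polar decomposition $T=U|T|$. Then the quaternionic Aluthge transform $\tilde T=|T|^{\frac12}U|T|^{\frac12}$ of $T$ is hyponormal.
   Context: $\mathbb{H}$ is the skew field of quaternions. A right quaternionic Hilbert space $\mathsf{H}$ is a right vector space over $\mathbb{H}$ with an inner product $\langle\cdot,\cdot\rangle:\mathsf{H}\times\mathsf{H}\to\mathbb{H}$ satisfying $\overline{\langle u,v\rangle}=\langle v,u\rangle$, $\langle u,u\rangle>0$ for $u\neq 0$, and $\langle u,vp+wq\rangle=\langle u,v\rangle p+\langle u,w\rangle q$ for $u,v,w\in\mathsf{H}$, $p,q\in\mathbb{H}$, complete in the norm $\|u\|=\sqrt{\langle u,u\rangle}$. $\mathfrak{B}(\mathsf{H})$ is the set of bounded right linear operators $T:\mathsf{H}\to\mathsf{H}$, i.e. $T(up+v)=(Tu)p+Tv$. Adjoint and selfadjoint are defined as in the complex case. $T\ge 0$ (positive) means $\langle Tx,x\rangle\geq 0$ for all $x\in\mathsf{H}$ (positive operators are selfadjoint), and $S\leq T$ means $T-S\geq 0$. The spherical spectrum $\sigma_S(T)$ is the set of $q\in\mathbb{H}$ for which $\Delta_q(T):=T^2-T(q+\bar q)+I|q|^2$ has no inverse in $\mathfrak{B}(\mathsf{H})$; for $T\ge0$ it is contained in $[0,+\infty)$. For $T\geq 0$ and $t>0$, $T^t$ is $f(T)$ with $f(s)=s^t$ on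 $\sigma_S(T)$, in the quaternionic continuous functional calculus $\mathcal{C}(\sigma_S(T),\mathbb{R})\to\mathfrak{B}(\mathsf{H})$ (the continuous unital homomorphism of real Banach algebras sending the identity function to $T$; its values are selfadjoint and it is positivity preserving). Polar decomposition: $T=U|T|$ with $|T|=(T^*T)^{1/2}$ and $U\in\mathfrak{B}(\mathsf{H})$ the unique operator with $T=U|T|$, $\|Uu\|=\|u\|$ for all $u\in(\ker|T|)^\perp$, and $Uu=0$ for $u\in\ker|T|=\ker T$. For $0<p\leq 1$, $T$ is $p$-hyponormal if $(T^*T)^p\geq(TT^* )^p$; hyponormal means $1$-hyponormal, i.e. $T^*T\geq TT^*$. *)

(* Defs.v *)
From HB Require Import structures.
From mathcomp Require Import all_boot all_order all_algebra.
From mathcomp Require Import ring.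
From mathcomp Require Import all_classical all_reals all_analysis.
Set Implicit Arguments.
Unset Strict Implicit.
Unset Printing Implicit Defensive.
Import Order.TTheory GRing.Theory Num.Theory.
Import numFieldNormedType.Exports.
Local Open Scope classical_set_scope.
Local Open Scope ring_scope.

(* Quat a b c d is a + b i + c j + d k. *)
Record quat (R : Type) := Quat { qre : R; qi : R; qj : R; qk : R }.

Section QuatTheory.
Variable R : realType.
Implicit Types x y z : quat R.

Definition tuple_of_quat x := (qre x, qi x, qj x, qk x).
Definition quat_of_tuple (t : R * R * R * R) :=
  let: (a, b, c, d) := t in Quat a b c d.

Lemma tuple_of_quatK : cancel tuple_of_quat quat_of_tuple.
Proof. by case. Qed.

HB.instance Definition _ := Choice.copy (quat R) (can_type tuple_of_quatK).

Definition addq x y :=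
  Quat (qre x + qre y) (qi x + qi y) (qj x + qj y) (qk x + qk y).

Definition oppq x := Quat (- qre x) (- qi x) (- qj x) (- qk x).

Definition mulq x y :=
  Quat (qre x * qre y - qi x * qi y - qj x * qj y - qk x * qk y)
       (qre x * qi y + qi x * qre y + qj x * qk y - qk x * qj y)
       (qre x * qj y - qi x * qk y + qj x * qre y + qk x * qi y)
       (qre x * qk y + qi x * qj y - qj x * qi y + qk x * qre y).

Definition qreal (r : R) := Quat r 0 0 0.

Lemma addqA : associative addq.
Proof. by move=> [????] [????] [????]; rewrite /addq /= !addrA. Qed.

Lemma addqC : commutative addq.
Proof. by move=> [a b c d] [????]; congr Quat; rewrite /= addrC. Qed.

Lemma add0q : left_id (qreal 0) addq.
Proof. by move=> [????]; rewrite /addq /= !add0r. Qed.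

Lemma addNq : left_inverse (qreal 0) oppq addq.
Proof. by move=> [????]; rewrite /addq /= !addNr. Qed.

HB.instance Definition _ :=
  GRing.isZmodule.Build (quat R) addqA addqC add0q addNq.

Lemma mulqA : associative mulq.
Proof. by move=> [????] [????] [????]; congr Quat => /=; ring. Qed.

Lemma mul1q : left_id (qreal 1) mulq.
Proof. by move=> [????]; congr Quat => /=; ring. Qed.

Lemma mulq1 : right_id (qreal 1) mulq.
Proof. by move=> [????]; congr Quat => /=; ring. Qed.

Lemma mulqDl : left_distributive mulq addq.
Proof. by move=> [????] [????] [????]; congr Quat => /=; ring. Qed.

Lemma mulqDr : right_distributive mulq addq.
Proof. by move=> [????] [????] [????]; congr Quat => /=; ring. Qed.

Lemma oneq_neq0 : qreal 1 != 0 :> quat R.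
Proof. by apply/eqP => -[] /eqP; rewrite oner_eq0. Qed.

HB.instance Definition _ := GRing.Zmodule_isNzRing.Build (quat R)
  mulqA mul1q mulq1 mulqDl mulqDr oneq_neq0.

Definition qconj x := Quat (qre x) (- qi x) (- qj x) (- qk x).

Definition qnormsq x : R := qre x ^+ 2 + qi x ^+ 2 + qj x ^+ 2 + qk x ^+ 2.

(* The orders q >= 0 and q > 0 on quaternions include that q is real. *)
Definition qge0 x := exists2 r : R, 0 <= r & x = qreal r.
Definition qgt0 x := exists2 r : R, 0 < r & x = qreal r.

End QuatTheory.

(* A right vector space over the quaternions is a left module over the
   converse ring: for u : V and q : quat R, the product u q is rscale u q. *)
Definition rscale (R : realType) (V : lmodType (quat R)^c) (u : V)
  (q : quat R) : V := (q : (quat R)^c) *: u.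

HB.mixin Record isRightQuatHilbert (R : realType) V
    of GRing.Lmodule (quat R)^c V := {
  inner : V -> V -> quat R;
  inner_conj : forall u v : V, qconj (inner u v) = inner v u;
  inner_gt0 : forall u : V, u != 0 -> qgt0 (inner u u);
  inner_linear : forall (u v w : V) (p q : quat R),
    inner u (rscale v p + rscale w q) = inner u v * p + inner u w * q;
  inner_complete : forall x : nat -> V,
    (forall e : R, 0 < e -> exists N : nat, forall m n : nat,
      (N <= m)%N -> (N <= n)%N ->
      Num.sqrt (qre (inner (x m - x n) (x m - x n))) < e) ->
    exists l : V, forall e : R, 0 < e -> exists N : nat, forall n : nat,
      (N <= n)%N -> Num.sqrt (qre (inner (x n - l) (x n - l))) < e
}.

#[short(type="rightQuatHilbertType")]
HB.structure Definition RightQuatHilbert (R : realType) :=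
  { V of isRightQuatHilbert R V & GRing.Lmodule (quat R)^c V }.

Section Operators.
Variables (R : realType) (H : rightQuatHilbertType R).
Implicit Types (T S U : H -> H) (u v : H).

Definition hnorm u : R := Num.sqrt (qre (inner u u)).

Definition right_linear T :=
  forall u v (p : quat R), T (rscale u p + v) = rscale (T u) p + T v.

(* The set B(H). *)
Definition bounded_operator : set (H -> H) :=
  [set T | right_linear T /\
           exists M : R, forall u, hnorm (T u) <= M * hnorm u].

Definition is_adjoint T S := forall u v, inner (S u) v = inner u (T v).

Definition adjoint T : H -> H :=
  xget (fun=> 0) [set S | bounded_operator S /\ is_adjoint T S].

Definition positive_operator T := forall u, qge0 (inner (T u) u).

Definition operator_le S T := positive_operator (fun u => T u - S u).

Definition invertible_operator T :=
  exists S, [/\ bounded_operator S, cancel T S & cancel S T].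

(* Delta_q(T) = T^2 - T (q + conj q) + I |q|^2; the coefficients are real. *)
Definition spherical_delta T (q : quat R) : H -> H := fun u =>
  T (T u) - rscale (T u) (q + qconj q) + rscale u (qreal (qnormsq q)).

Definition spherical_spectrum T : set (quat R) :=
  [set q | ~ invertible_operator (spherical_delta T q)].

(* For selfadjoint T the spherical spectrum is real; the functional calculus
   is only used for such T, with the spectrum seen as a subset of R. *)
Definition real_spectrum T : set R :=
  [set s | spherical_spectrum T (qreal s)].

(* Phi is a continuous unital homomorphism of real Banach algebras from
   C(sigma_S(T), R), with the sup norm, to B(H), mapping the identity function
   to T. Elements of C(sigma_S(T), R) are represented by functions R -> R
   continuous on the spectrum, up to equality there; the values of Phi on other
   functions are irrelevant. *)
Record is_continuous_calculus T (Phi : (R -> R) -> H -> H) : Prop := {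
  calc_bounded : forall f : R -> R, {within real_spectrum T, continuous f} ->
    bounded_operator (Phi f);
  calc_ext : forall f g : R -> R, {within real_spectrum T, continuous f} ->
    {within real_spectrum T, continuous g} ->
    (forall s, real_spectrum T s -> f s = g s) -> Phi f = Phi g;
  calcD : forall f g : R -> R, {within real_spectrum T, continuous f} ->
    {within real_spectrum T, continuous g} ->
    Phi (fun s => f s + g s) = (fun u => Phi f u + Phi g u);
  calcZ : forall (r : R) (f : R -> R), {within real_spectrum T, continuous f} ->
    Phi (fun s => r * f s) = (fun u => rscale (Phi f u) (qreal r));
  calcM : forall f g : R -> R, {within real_spectrum T, continuous f} ->
    {within real_spectrum T, continuous g} ->
    Phi (fun s => f s * g s) = Phi f \o Phi g;
  calc1 : Phi (fun=> 1) = id;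
  calc_id : Phi id = T;
  calc_continuous : exists C : R,
    forall (f : R -> R) (M : R), {within real_spectrum T, continuous f} -> 0 <= M ->
    (forall s, real_spectrum T s -> `|f s| <= M) ->
    forall u, hnorm (Phi f u) <= C * M * hnorm u
}.

(* The operator f(T). *)
Definition fcalc T : (R -> R) -> H -> H :=
  xget (fun _ _ => 0) [set Phi | is_continuous_calculus T Phi].

Definition opow T (t : R) : H -> H := fcalc T (fun s => s `^ t).

Definition absop T : H -> H := opow (adjoint T \o T) 2^-1.

Definition polar_decomposition T U :=
  [/\ bounded_operator U,
      T = U \o absop T,
      (forall u, (forall v, absop T v = 0 -> inner u v = 0) ->
         hnorm (U u) = hnorm u)
    & forall u, absop T u = 0 -> U u = 0].

Definition p_hyponormal (p : R) T :=
  bounded_operator T /\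
  operator_le (opow (T \o adjoint T) p) (opow (adjoint T \o T) p).

Definition hyponormal T :=
  bounded_operator T /\ operator_le (T \o adjoint T) (adjoint T \o T).

Definition aluthge T U : H -> H :=
  opow (absop T) 2^-1 \o U \o opow (absop T) 2^-1.

End Operators.

(* Main.v *)
(* Write V for the adjoint of U, A = T*T, B = TT*, P = |T| and Q = |T|^(1/2).

   Loewner-Heinz turns B^p <= A^p into B^(1/2) <= A^(1/2) = P. The operator
   C = U P V is positive with C^2 = B, hence C <= B^(1/2) <= P. The transform is
   t = Q U Q, so t t* = Q C Q <= Q P Q = P^2, while
   t* t = Q V P U Q >= Q V C U Q = Q P Q = P^2 because V U P = P.

   The calculus is only specified axiomatically, so selfadjointness of A^t is
   proved first for dyadic t, approximating square roots by polynomials, and then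
   by continuity in t. Loewner-Heinz is likewise obtained from the fact that
   {t | B^t <= A^t} is closed and stable under midpoints. A calculus for TT* is
   transported from the one for T*T by f |-> U f(A) V + f(0) (1 - U V). *)
Require Import Defs.
From HB Require Import structures.
From mathcomp Require Import all_boot all_order all_algebra.
From mathcomp Require Import ring lra.
From mathcomp Require Import all_classical all_reals all_analysis.
Set Implicit Arguments.
Unset Strict Implicit.
Unset Printing Implicit Defensive.
Import Order.TTheory GRing.Theory Num.Theory.
Import numFieldNormedType.Exports.
Local Open Scope classical_set_scope.
Local Open Scope ring_scope.

(** All estimates use only the real part [ip] of the inner product; quaternionic identities are
    recovered by moving an arbitrary scalar into the second argument. The transport of the calculus
    to [T T*] is forced by the encoding: [fcalc] takes a default value when no calculus exists, and
    then the powers of [T T*] in the hypothesis would be [0] and say nothing. The axioms of a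
    calculus mention neither adjoints nor order, so powers of different operators are compared
    through one inequality, [geometric_mean_le]: for commuting symmetric pairs [X, Y] and [F, G],
    with [F], [G] and [F G] nonnegative, [|X u| <= |F u|] and [|Y u| <= |G u|] imply [X Y <= F G].
    With [X = F = 1] it is monotonicity of the square root, which yields both the halving of an
    exponent and [C <= B^(1/2)]; with powers of [B] and [A] it is the midpoint step of
    Loewner-Heinz. *)

(** * The real inner product underlying the quaternionic one *)

Section RealInnerProduct.
Variables (R : realType) (H : rightQuatHilbertType R).
Implicit Types (u v w : H) (r s : R) (p q : quat R).

Definition ip u v : R := qre (inner u v).
Definition rs r u : H := rscale u (qreal r).

Lemma qconjD p q : qconj (p + q) = qconj p + qconj q.
Proof. by case: p q => [????] [????]; congr Quat => /=; ring. Qed.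

Lemma qconjM p q : qconj (p * q) = qconj q * qconj p.
Proof. by case: p q => [????] [????]; congr Quat => /=; ring. Qed.

Lemma qconj_real r : qconj (qreal r) = qreal r.
Proof. by congr Quat => /=; rewrite oppr0. Qed.

Lemma qreM_real p r : qre (p * qreal r) = r * qre p.
Proof. by case: p => [????] /=; ring. Qed.

Lemma qreal_mulC p r : p * qreal r = qreal r * p.
Proof. by case: p => [????]; congr Quat => /=; ring. Qed.

Lemma qre_mul_eq p q : (forall x, qre (p * x) = qre (q * x)) -> p = q.
Proof.
case: p q => [a b c d] [a' b' c' d'] E.
have := E (Quat 1 0 0 0); have := E (Quat 0 1 0 0).
have := E (Quat 0 0 1 0); have := E (Quat 0 0 0 1) => /=.
rewrite !(mulr0, mulr1, subr0, sub0r, oppr0, addr0, add0r).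
by move=> /oppr_inj -> /oppr_inj -> /oppr_inj -> ->.
Qed.

Lemma rscaleDl u p q : rscale u (p + q) = rscale u p + rscale u q.
Proof. exact: (@scalerDl (quat R)^c H u p q). Qed.

Lemma rscaleDr u v p : rscale (u + v) p = rscale u p + rscale v p.
Proof. exact: (@scalerDr (quat R)^c H p u v). Qed.

Lemma rscaleA u p q : rscale (rscale u p) q = rscale u (p * q).
Proof. exact: (@scalerA (quat R)^c H q p u). Qed.

Lemma rscale1 u : rscale u 1 = u.
Proof. exact: (@scale1r (quat R)^c H u). Qed.

Lemma rscale0 u : rscale u 0 = 0.
Proof. exact: (@scale0r (quat R)^c H u). Qed.

Lemma rscale0r p : rscale (0 : H) p = 0.
Proof. exact: (@scaler0 (quat R)^c H p). Qed.

Lemma rscaleNr u p : rscale (- u) p = - rscale u p.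
Proof. exact: (@scalerN (quat R)^c H p u). Qed.

Lemma rs_rscale u r p : rscale (rs r u) p = rs r (rscale u p).
Proof. by rewrite /rs !rscaleA qreal_mulC. Qed.

Lemma rsD r u v : rs r (u + v) = rs r u + rs r v.
Proof. exact: rscaleDr. Qed.

Lemma rsDl r s u : rs (r + s) u = rs r u + rs s u.
Proof. by rewrite /rs -rscaleDl; congr rscale; congr Quat => /=; rewrite addr0. Qed.

Lemma rsM r s u : rs (r * s) u = rs r (rs s u).
Proof. by rewrite /rs rscaleA; congr rscale; congr Quat => /=; ring. Qed.

Lemma rs1 u : rs 1 u = u. Proof. exact: rscale1. Qed.
Lemma rs0 u : rs 0 u = 0. Proof. exact: rscale0. Qed.
Lemma rs0r r : rs r 0 = 0. Proof. exact: rscale0r. Qed.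
Lemma rsN r u : rs r (- u) = - rs r u. Proof. exact: rscaleNr. Qed.

Lemma rsNl r u : rs (- r) u = - rs r u.
Proof. by apply/eqP; rewrite -addr_eq0 -rsDl addNr rs0. Qed.

Lemma rsB r u v : rs r (u - v) = rs r u - rs r v.
Proof. by rewrite rsD rsN. Qed.

Lemma innerDr u v w : inner u (v + w) = inner u v + inner u w.
Proof. by have := inner_linear u v w 1 1; rewrite !rscale1 !mulr1. Qed.

Lemma innerZr u v p : inner u (rscale v p) = inner u v * p.
Proof. by have := inner_linear u v v p 0; rewrite rscale0 mulr0 !addr0. Qed.

Lemma innerDl u v w : inner (u + v) w = inner u w + inner v w.
Proof. by rewrite -inner_conj innerDr qconjD !inner_conj. Qed.

Lemma innerZl u v p : inner (rscale u p) v = qconj p * inner u v.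
Proof. by rewrite -inner_conj innerZr qconjM !inner_conj. Qed.

Lemma ipC u v : ip u v = ip v u.
Proof. by rewrite /ip -inner_conj. Qed.

Lemma ipDr u v w : ip u (v + w) = ip u v + ip u w.
Proof. by rewrite /ip innerDr. Qed.

Lemma ipDl u v w : ip (u + v) w = ip u w + ip v w.
Proof. by rewrite /ip innerDl. Qed.

Lemma ipZr r u v : ip u (rs r v) = r * ip u v.
Proof. by rewrite /ip innerZr qreM_real. Qed.

Lemma ipZl r u v : ip (rs r u) v = r * ip u v.
Proof. by rewrite ipC ipZr ipC. Qed.

Lemma ip0r u : ip u 0 = 0.
Proof. by rewrite -(rs0 0) ipZr mul0r. Qed.

Lemma ip0l u : ip 0 u = 0.
Proof. by rewrite ipC ip0r. Qed.

Lemma ipNr u v : ip u (- v) = - ip u v.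
Proof. by apply/eqP; rewrite -addr_eq0 -ipDr addNr ip0r. Qed.

Lemma ipNl u v : ip (- u) v = - ip u v.
Proof. by rewrite ipC ipNr ipC. Qed.

Definition ipE := (ipDl, ipDr, ipNl, ipNr, ipZl, ipZr).

Lemma ip_ge0 u : 0 <= ip u u.
Proof.
have [->|/inner_gt0[r r0]] := eqVneq u 0; first by rewrite ip0r.
by rewrite /ip => -> /=; exact: ltW.
Qed.

Lemma ip_eq0 u : ip u u = 0 -> u = 0.
Proof.
apply: contraPP => /eqP /inner_gt0[r r0].
by rewrite /ip => -> /= r00; rewrite r00 ltxx in r0.
Qed.

Lemma ip_ext u v : (forall w, ip u w = ip v w) -> u = v.
Proof.
move=> E; apply/eqP; rewrite -subr_eq0; apply/eqP; apply: ip_eq0.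
by rewrite ipDl ipNl E subrr.
Qed.

(** The real parts of [q * x], for [x] among the units [1, i, j, k], are up to sign the components
    of [q], and the factor [x] can be absorbed into the second argument. *)
Lemma inner_ip_eq u v u' v' :
  (forall p, ip u (rscale v p) = ip u' (rscale v' p)) -> inner u v = inner u' v'.
Proof. by move=> E; apply: qre_mul_eq => p; rewrite -!innerZr; exact: E. Qed.

Lemma hnorm_ge0 u : 0 <= hnorm u.
Proof. exact: sqrtr_ge0. Qed.

Lemma hnorm_sqr u : hnorm u ^+ 2 = ip u u.
Proof. by rewrite sqr_sqrtr // ip_ge0. Qed.

Lemma hnorm0 : hnorm (0 : H) = 0.
Proof. by rewrite /hnorm [qre _](ip0r 0) sqrtr0. Qed.

Lemma hnorm_eq0 u : hnorm u = 0 -> u = 0.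
Proof. by move=> u0; apply: ip_eq0; rewrite -hnorm_sqr u0 expr0n. Qed.

Lemma hnorm_le u r : 0 <= r -> ip u u <= r ^+ 2 -> hnorm u <= r.
Proof. by move=> r0; rewrite -hnorm_sqr ler_sqr // nnegrE hnorm_ge0. Qed.

Lemma hnormZ r u : hnorm (rs r u) = `|r| * hnorm u.
Proof.
by rewrite /hnorm -/(ip _ _) ipZl ipZr mulrA -expr2 sqrtrM ?sqr_ge0// sqrtr_sqr.
Qed.

Lemma hnormN u : hnorm (- u) = hnorm u.
Proof. by rewrite /hnorm -!/(ip _ _) ipNl ipNr opprK. Qed.

Lemma hnormC u v : hnorm (u - v) = hnorm (v - u).
Proof. by rewrite -hnormN opprB. Qed.

Lemma discr_le (a b c : R) : 0 <= a ->
  (forall t, 0 <= a * t ^+ 2 + 2 * b * t + c) -> b ^+ 2 <= a * c.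
Proof.
rewrite le_eqVlt => /predU1P[<- E|a0 E].
  have [->|b0] := eqVneq b 0; first by rewrite expr0n mul0r.
  (* At this [t] the affine form takes the value [-1]. *)
  have := E (- (c + 1) / (2 * b)).
  rewrite mul0r add0r mulrC divfK ?mulf_neq0 ?pnatr_eq0//; lra.
have := E (- b / a).
have -> : a * (- b / a) ^+ 2 + 2 * b * (- b / a) + c = (a * c - b ^+ 2) / a.
  by field; rewrite gt_eqF.
by rewrite pmulr_lge0 ?invr_gt0// subr_ge0.
Qed.

Definition symmetric_op (T : H -> H) := forall u v, ip (T u) v = ip u (T v).
Definition nonneg_op (T : H -> H) := forall u, 0 <= ip (T u) u.

End RealInnerProduct.

(** * Bounded operators and Cauchy-Schwarz for nonnegative forms *)

Section BoundedOperators.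
Variables (R : realType) (H : rightQuatHilbertType R).
Implicit Types (u v w : H) (r s : R) (p q : quat R) (S T : H -> H).

Lemma bopD T u v : bounded_operator T -> T (u + v) = T u + T v.
Proof. by case=> l _; have := l u v 1; rewrite !rscale1. Qed.

Lemma bop0 T : bounded_operator T -> T 0 = 0.
Proof. by move=> bT; apply: (addrI (T 0)); rewrite -bopD // !addr0. Qed.

Lemma bopZr T u p : bounded_operator T -> T (rscale u p) = rscale (T u) p.
Proof. by move=> bT; have := bT.1 u 0 p; rewrite addr0 (bop0 bT) addr0. Qed.

Lemma bopZ T r u : bounded_operator T -> T (rs r u) = rs r (T u).
Proof. exact: bopZr. Qed.

Lemma bopN T u : bounded_operator T -> T (- u) = - T u.
Proof. by move=> bT; apply/eqP; rewrite -addr_eq0 -bopD // addNr bop0. Qed.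

Lemma bopB T u v : bounded_operator T -> T (u - v) = T u - T v.
Proof. by move=> bT; rewrite bopD // bopN. Qed.

Definition bopE T (bT : bounded_operator T) :=
  ((fun u v => bopD u v bT), (fun u => bopN u bT), (fun r u => bopZ r u bT)).

Lemma bop_bound T : bounded_operator T ->
  exists2 M : R, 0 < M & forall u, hnorm (T u) <= M * hnorm u.
Proof.
case=> _ [M hM]; exists (`|M| + 1); first by rewrite ltr_wpDl.
move=> u; apply: le_trans (hM u) _; apply: ler_wpM2r; first exact: hnorm_ge0.
by rewrite (le_trans (ler_norm M))// lerDl.
Qed.

Lemma nonneg_cauchy_schwarz T u v : bounded_operator T -> symmetric_op T -> nonneg_op T ->
  ip (T u) v ^+ 2 <= ip (T u) u * ip (T v) v.
Proof.
move=> bT sT nT; rewrite [leRHS]mulrC; apply: discr_le => // t.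
have := nT (u + rs t v); rewrite bopD // bopZ // !ipE.
rewrite (sT v u) (ipC v (T u)); congr (_ <= _); ring.
Qed.

Lemma bop_id : bounded_operator (@id H).
Proof. by split=> // ; exists 1 => u; rewrite mul1r. Qed.

Lemma bop_comp S T : bounded_operator S -> bounded_operator T ->
  bounded_operator (S \o T).
Proof.
move=> bS bT; have [M M0 hM] := bop_bound bS; have [N N0 hN] := bop_bound bT.
split; first by move=> u v p /=; rewrite bT.1 bS.1.
exists (M * N) => u /=; rewrite -mulrA; apply: le_trans (hM _) _.
by rewrite ler_pM2l.
Qed.

Lemma cauchy_schwarz u v : ip u v ^+ 2 <= ip u u * ip v v.
Proof. by apply: nonneg_cauchy_schwarz bop_id _ _ => // w; exact: ip_ge0. Qed.

Lemma ip_le u v : ip u v <= hnorm u * hnorm v.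
Proof.
apply: le_trans (ler_norm _) _; rewrite -ler_sqr ?nnegrE ?mulr_ge0 ?hnorm_ge0//.
by rewrite real_normK ?num_real// exprMn !hnorm_sqr cauchy_schwarz.
Qed.

Lemma hnorm_triangle u v : hnorm (u + v) <= hnorm u + hnorm v.
Proof.
apply: hnorm_le; first by rewrite addr_ge0 ?hnorm_ge0.
rewrite sqrrD !hnorm_sqr !ipE (ipC v u).
have := ip_le u v; lra.
Qed.

Lemma bop_add S T : bounded_operator S -> bounded_operator T ->
  bounded_operator (fun u => S u + T u).
Proof.
move=> bS bT; have [M M0 hM] := bop_bound bS; have [N N0 hN] := bop_bound bT.
split; first by move=> u v p /=; rewrite bS.1 bT.1 rscaleDr addrACA.
exists (M + N) => u; rewrite mulrDl; apply: le_trans (hnorm_triangle _ _) _.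
exact: lerD.
Qed.

Lemma bop_scale r T : bounded_operator T -> bounded_operator (fun u => rs r (T u)).
Proof.
move=> bT; have [M M0 hM] := bop_bound bT.
split; first by move=> u v p /=; rewrite bT.1 rsD rs_rscale.
exists (`|r| * M) => u; rewrite hnormZ -mulrA.
by apply: ler_wpM2l.
Qed.

Lemma bop_sub S T : bounded_operator S -> bounded_operator T ->
  bounded_operator (fun u => S u - T u).
Proof.
move=> bS bT; have := bop_add bS (bop_scale (-1) bT).
by under eq_fun do rewrite rsNl rs1.
Qed.

Lemma bop_zero : bounded_operator (fun _ : H => 0 : H).
Proof.
by split=> [u v p|]; [rewrite rscale0r addr0 | exists 0 => u; rewrite hnorm0 mul0r].
Qed.

Lemma symmetric_inner T u v : bounded_operator T -> symmetric_op T ->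
  inner (T u) v = inner u (T v).
Proof. by move=> bT sT; apply: inner_ip_eq => p; rewrite sT bopZr. Qed.

(** Symmetry makes [inner (T u) u] its own conjugate, so its imaginary components vanish and only
    the sign of the real part matters. *)
Lemma positive_symmetric T : bounded_operator T -> symmetric_op T ->
  nonneg_op T -> positive_operator T.
Proof.
move=> bT sT nT u; have := nT u; rewrite /ip.
have := inner_conj (T u) u; rewrite -(symmetric_inner _ _ bT sT).
case: (inner (T u) u) => [a b c d] [] /= hb hc hd a0; exists a => //.
by congr Quat; lra.
Qed.

Lemma positive_nonneg T : positive_operator T -> nonneg_op T.
Proof. by move=> pT u; have [r r0 E] := pT u; rewrite /ip E. Qed.

(** This is [T^2 <= M T]. Cauchy-Schwarz for the form [ip (T u) v], applied to [u] and [T u], bounds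
    [|T u|^4] by [ip (T u) u] times [ip (T (T u)) (T u)], and the last factor is at most
    [M |T u|^2]. *)
Lemma nonneg_op_bound T M : bounded_operator T -> symmetric_op T -> nonneg_op T ->
  (forall u, hnorm (T u) <= M * hnorm u) ->
  forall u, ip (T u) (T u) <= M * ip (T u) u.
Proof.
move=> bT sT nT hM u; have [Tu0|Tu0] := eqVneq (ip (T u) (T u)) 0.
  have -> : ip (T u) u = 0 by rewrite (ip_eq0 Tu0) ip0l.
  by rewrite Tu0 mulr0.
have Tu_gt0 : 0 < ip (T u) (T u) by rewrite lt_neqAle eq_sym Tu0 ip_ge0.
have := nonneg_cauchy_schwarz u (T u) bT sT nT.
have := ip_le (T (T u)) (T u).
have := ler_wpM2r (hnorm_ge0 (T u)) (hM (T u)); rewrite -mulrA -expr2 hnorm_sqr.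
move=> h1 h2 h3; have h4 := le_trans h2 h1.
rewrite -(ler_pM2l Tu_gt0) -expr2; apply: le_trans h3 _.
rewrite [leRHS](_ : _ = ip (T u) u * (M * ip (T u) (T u))); last by ring.
by apply: ler_wpM2l.
Qed.

End BoundedOperators.

(** * Energy minimization, existence of adjoints, inverses of coercive operators *)

Section LaxMilgram.
Variables (R : realType) (H : rightQuatHilbertType R).
Implicit Types (u v w : H) (r s : R) (p q : quat R) (S T : H -> H).

Lemma vanishing_seq : exists d : nat -> R, (forall n, 0 < d n) /\
  forall e : R, 0 < e -> exists N : nat, forall n, (N <= n)%N -> d n < e.
Proof.
exists (fun n => n.+1%:R^-1); split=> [n|e e0]; first by rewrite invr_gt0 ltr0n.
exists (Num.bound e^-1) => n Nn; rewrite invf_plt ?posrE ?ltr0n//.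
apply: lt_le_trans (archi_boundP _) _; first by rewrite invr_ge0 ltW.
by rewrite ler_nat (leq_trans Nn).
Qed.

(* The solution minimizes the energy [<X v, v> - 2 phi v]. *)
Lemma lax_milgram (X : H -> H) (c K : R) (phi : H -> R) :
  bounded_operator X -> symmetric_op X -> 0 < c ->
  (forall u, c * ip u u <= ip (X u) u) ->
  (forall r u v, phi (rs r u + v) = r * phi u + phi v) ->
  (forall u, `|phi u| <= K * hnorm u) ->
  exists w, forall v, ip (X w) v = phi v.
Proof.
move=> bX sX c0 hc phiL phiK.
have phi0 : phi 0 = 0.
  by apply: (addrI (phi 0)); rewrite -{1}[phi 0]mul1r -phiL rs1 !addr0.
have phiZ r u : phi (rs r u) = r * phi u by have := phiL r u 0; rewrite phi0 !addr0.
pose J v := ip (X v) v - 2 * phi v.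
have J_lb v : - (K ^+ 2 / c) <= J v.
  have := hc v; have := le_trans (ler_norm _) (phiK v); rewrite -hnorm_sqr /J.
  move=> h1 h2.
  have : 0 <= (c * hnorm v - K) ^+ 2 / c by rewrite mulr_ge0 ?sqr_ge0// invr_ge0 ltW.
  have -> : (c * hnorm v - K) ^+ 2 / c
    = c * hnorm v ^+ 2 - 2 * (K * hnorm v) + K ^+ 2 / c by field; rewrite gt_eqF.
  lra.
have J_inf : has_inf (range J).
  split; first by exists (J 0); exists 0.
  by exists (- (K ^+ 2 / c)) => _ [v _ <-].
pose m := inf (range J).
have mJ v : m <= J v by apply: ge_inf; [exact: J_inf.2 | exists v].
have [d [d0 d_small]] := vanishing_seq.
have /choice[x xP] : forall n : nat, exists v, J v < m + d n.
  by move=> n; have [_ [v _ <-] hv] := inf_adherent (d0 n) J_inf; exists v.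
(* [J] stays above [m] on the line through [x n] in direction [v], so a quadratic in [t] has
   nonpositive discriminant: close to the infimum the derivative of [J] is small. *)
have quad n v : (ip (X (x n)) v - phi v) ^+ 2 <= ip (X v) v * (d n).
  apply: discr_le => [|t].
    by apply: le_trans (hc v); rewrite mulr_ge0 ?ip_ge0// ltW.
  have := mJ (rs t v + x n); have := xP n; rewrite /J phiL bopD // bopZ // !ipE.
  rewrite (sX v (x n)) (ipC v) => h1 h2.
  have -> : ip (X v) v * t ^+ 2 + 2 * (ip (X (x n)) v - phi v) * t + d n =
    (t * (t * ip (X v) v) + t * ip (X (x n)) v + (t * ip (X (x n)) v + ip (X (x n)) (x n)) -
      2 * (t * phi v + phi (x n))) - (ip (X (x n)) (x n) - 2 * phi (x n)) + d n by ring.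
  by rewrite -addrA -lerBlDr sub0r opprD opprK; apply: le_trans h2; move/ltW: h1; lra.
(* Parallelogram identity for [J]: the midpoint also has energy at least [m], so by coercivity a
   minimizing sequence is Cauchy. *)
have half n k : c * ip (x n - x k) (x n - x k) <= 2 * d n + 2 * d k.
  apply: le_trans (hc _) _.
  have := mJ (rs 2^-1 (x n) + rs 2^-1 (x k)); have := xP n; have := xP k.
  rewrite /J phiL phiZ !(bopE bX) !ipE.
  rewrite (sX (x k) (x n)) (ipC (x k)).
  lra.
have [l hl] : exists l, forall e : R, 0 < e -> exists N : nat, forall n : nat,
    (N <= n)%N -> hnorm (x n - l) < e.
  apply: inner_complete => e e0.
  have [N hN] := d_small (c * e ^+ 2 / 4) ltac:(by rewrite divr_gt0 ?mulr_gt0 ?exprn_gt0).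
  exists N => i j Ni Nj; rewrite -/(hnorm _) -ltr_sqr ?nnegrE ?hnorm_ge0 ?(ltW e0)//.
  rewrite hnorm_sqr -(ltr_pM2l c0); have := half i j.
  by have := hN _ Ni; have := hN _ Nj; lra.
exists l => v; apply/eqP; rewrite -subr_eq0 -normr_le0; apply/ler_addgt0Pl => e e0.
rewrite addr0.
have [M M0 hM] := bop_bound bX.
have Xv0 : 0 <= ip (X v) v by apply: le_trans (hc v); rewrite mulr_ge0 ?ip_ge0// ltW.
have [N1 hN1] := hl (e / 2 / (M * hnorm v + 1))
  ltac:(by rewrite !divr_gt0 ?ltr_wpDl ?mulr_ge0 ?hnorm_ge0 ?ltW).
have [N2 hN2] := d_small ((e / 2) ^+ 2 / (ip (X v) v + 1))
  ltac:(by rewrite divr_gt0 ?exprn_gt0 ?divr_gt0 ?ltr_wpDl).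
pose n := maxn N1 N2; have := hN1 n (leq_maxl _ _); have := hN2 n (leq_maxr _ _).
have := quad n v; set b := _ - phi v; set y := hnorm _ => h1 h2 h3.
have -> : ip (X l) v - phi v = b - ip (X (x n - l)) v.
  by rewrite /b bopB // !ipE; ring.
have h4 : `|ip (X (x n - l)) v| <= M * y * hnorm v.
  have hle := ler_wpM2r (hnorm_ge0 v) (hM (x n - l)).
  rewrite ler_norml lerNl -ipNl; apply/andP; split; apply: le_trans (ip_le _ _) _ => //.
  by rewrite hnormN.
have h5 : `|b| <= e / 2.
  rewrite -ler_sqr ?nnegrE ?divr_ge0 ?(ltW e0)// real_normK ?num_real//.
  apply: le_trans h1 _; move: h2; rewrite ltr_pdivlMr ?ltr_wpDl// mulrDr mulr1 mulrC.
  by have := d0 n; lra.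
have h6 : M * y * hnorm v <= e / 2.
  have hv := hnorm_ge0 v.
  move: h3; rewrite ltr_pdivlMr ?ltr_wpDl ?mulr_ge0 ?(ltW M0)//.
  have : 0 <= y by exact: hnorm_ge0.
  by rewrite mulrDr mulr1 mulrCA mulrA; lra.
by apply: le_trans (ler_normB _ _) _; lra.
Qed.

Lemma is_adjoint_bounded T S : bounded_operator T -> is_adjoint T S ->
  bounded_operator S.
Proof.
move=> bT aS; have [M M0 hM] := bop_bound bT; split=> [u v p|].
  apply: ip_ext => w; by rewrite /ip aS !innerDl !innerZl !aS.
exists M => u; have [Su0|Su0] := eqVneq (hnorm (S u)) 0.
  by rewrite Su0 mulr_ge0 ?hnorm_ge0 ?ltW.
have Sgt : 0 < hnorm (S u) by rewrite lt_neqAle eq_sym Su0 hnorm_ge0.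
rewrite -(ler_pM2r Sgt) -expr2 hnorm_sqr /ip aS -/(ip _ _).
apply: le_trans (ip_le _ _) _.
by rewrite [M * _]mulrC -mulrA; apply: ler_wpM2l (hM _); exact: hnorm_ge0.
Qed.

(** For the identity operator, [lax_milgram] is the Riesz representation theorem; it is applied to
    [v |-> ip u (T v)]. Linearity and boundedness then follow from the adjoint identity alone. *)
Lemma adjointP T : bounded_operator T ->
  bounded_operator (adjoint T) /\ is_adjoint T (adjoint T).
Proof.
move=> bT; have [M M0 hM] := bop_bound bT.
suff [S aS] : exists S, is_adjoint T S.
  by apply: (@xgetPex _ (fun=> 0)
    [set S | bounded_operator S /\ is_adjoint T S]); exists S; split=> //;
    exact: is_adjoint_bounded aS.
have /choice[S SP] : forall u, exists w, forall v, ip w v = ip u (T v).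
  move=> u; have [|||||w hw] := @lax_milgram id 1 (hnorm u * M) (fun v => ip u (T v)) (@bop_id _ _).
  - by [].
  - by [].
  - by move=> v; rewrite mul1r.
  - by move=> r v w; rewrite bopD // bopZ // !ipE.
  - move=> v; rewrite -mulrA ler_norml; apply/andP; split.
      rewrite lerNl -ipNl; apply: le_trans (ip_le _ _) _.
      by rewrite hnormN ler_wpM2l ?hnorm_ge0.
    by apply: le_trans (ip_le _ _) _; rewrite ler_wpM2l ?hnorm_ge0.
  - by exists w.
by exists S => u v; apply: inner_ip_eq => p; rewrite SP bopZr.
Qed.

(** Surjectivity comes from [lax_milgram]; the lower bound [c |u| <= |X u|] gives injectivity and
    bounds the inverse by [c^-1]. *)
Lemma coercive_invertible X c : bounded_operator X -> symmetric_op X -> 0 < c ->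
  (forall u, c * ip u u <= ip (X u) u) -> invertible_operator X.
Proof.
move=> bX sX c0 hc.
have /choice[S SP] : forall u, exists w, X w = u.
  move=> u; have [||w hw] := @lax_milgram X c (hnorm u) (fun v => ip u v) bX sX c0 hc.
  - by move=> r v w; rewrite !ipE.
  - move=> v; rewrite ler_norml; apply/andP; split; last exact: ip_le.
    by rewrite lerNl -ipNl; apply: le_trans (ip_le _ _) _; rewrite hnormN.
  - by exists w; apply: ip_ext.
have X_lb u : c * hnorm u <= hnorm (X u).
  have [->|u0] := eqVneq (hnorm u) 0; first by rewrite mulr0 hnorm_ge0.
  have ugt : 0 < hnorm u by rewrite lt_neqAle eq_sym u0 hnorm_ge0.
  rewrite -(ler_pM2r ugt) -mulrA -expr2 hnorm_sqr.
  exact: le_trans (hc u) (ip_le _ _).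
have X_inj : injective X.
  move=> u v E; apply/eqP; rewrite -subr_eq0; apply/eqP/hnorm_eq0/eqP.
  rewrite eq_le hnorm_ge0 andbT -(ler_pM2l c0) mulr0.
  by apply: le_trans (X_lb _) _; rewrite bopB // E subrr hnorm0.
have XK : cancel X S by move=> u; apply: X_inj; rewrite SP.
exists S; split=> //; split=> [u v p|]; first by apply: X_inj; rewrite SP bX.1 !SP.
by exists c^-1 => u; rewrite ler_pdivlMl // -{2}(SP u).
Qed.

End LaxMilgram.

(** * The real spherical spectrum of a symmetric operator *)

Section RealSpectrum.
Variables (R : realType) (H : rightQuatHilbertType R).
Implicit Types (u v w : H) (r s c : R) (X Y : H -> H).

Definition op_shift X s : H -> H := fun u => X u - rs s u.

Lemma bop_shift X s : bounded_operator X -> bounded_operator (op_shift X s).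
Proof. by move=> bX; apply: bop_sub bX (bop_scale s (@bop_id _ _)). Qed.

Lemma spherical_delta_real X s : bounded_operator X ->
  spherical_delta X (qreal s) = op_shift X s \o op_shift X s.
Proof.
move=> bX; apply/funext => u; rewrite /spherical_delta /op_shift /=.
rewrite (_ : qreal s + qconj (qreal s) = qreal (s + s)); last first.
  by rewrite qconj_real; congr Quat; rewrite /= addr0.
rewrite (_ : qreal (qnormsq (qreal s)) = qreal (s * s)); last first.
  by rewrite /qnormsq /= expr2 !expr0n !addr0.
rewrite -/(rs _ _) -/(rs _ _) rsDl rsM !(bopE bX) rsD rsN !opprD opprK !addrA.
by congr (_ + _); rewrite -!addrA.
Qed.

(** An inverse [S] of [Y^2] commutes with [Y], so [S Y] inverts [Y]. At a real point
    [spherical_delta] is a square, and the spherical spectrum thereby reduces to the usual one. *)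
Lemma invertible_square Y : bounded_operator Y ->
  invertible_operator (Y \o Y) <-> invertible_operator Y.
Proof.
move=> bY; split=> -[S [bS SK KS]].
  have comm u : Y (S u) = S (Y u).
    by rewrite -{2}(KS u) -(SK (Y (S u))).
  exists (S \o Y); split; first exact: bop_comp.
    by move=> u /=; rewrite -[Y (Y u)]/((Y \o Y) u) SK.
  by move=> u /=; rewrite comm -[Y (Y u)]/((Y \o Y) u) SK.
exists (S \o S); split; first exact: bop_comp.
  by move=> u /=; rewrite !SK.
by move=> u /=; rewrite !KS.
Qed.

Lemma real_spectrumP X s : bounded_operator X ->
  real_spectrum X s <-> ~ invertible_operator (op_shift X s).
Proof.
move=> bX; rewrite /real_spectrum /spherical_spectrum /= spherical_delta_real //.
by have [h1 h2] := invertible_square (bop_shift s bX); split=> h i; apply: h; [exact: h2|exact: h1].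
Qed.

Lemma invertible_opp Y : invertible_operator (fun u => - Y u) ->
  invertible_operator Y.
Proof.
case=> S [bS SK KS]; exists (fun u => S (- u)); split.
- have := bop_scale (-1) bS.
  by congr bounded_operator; apply/funext => u; rewrite rsNl rs1 (bopN _ bS).
- exact: SK.
- by move=> u; apply: oppr_inj; exact: KS.
Qed.

Lemma real_spectrum_ge X c s : bounded_operator X -> symmetric_op X ->
  (forall u, c * ip u u <= ip (X u) u) -> real_spectrum X s -> c <= s.
Proof.
move=> bX sX hc; rewrite leNgt => /(real_spectrumP _ bX) inv; apply/negP => sc; apply: inv.
apply: (@coercive_invertible _ _ _ (c - s)).
- exact: bop_shift.
- by move=> u v; rewrite /op_shift !ipE sX.
- by rewrite subr_gt0.
- by move=> u; rewrite /op_shift !ipE mulrBl lerD2r.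
Qed.

Lemma real_spectrum_le X c s : bounded_operator X -> symmetric_op X ->
  (forall u, ip (X u) u <= c * ip u u) -> real_spectrum X s -> s <= c.
Proof.
move=> bX sX hc; rewrite leNgt => /(real_spectrumP _ bX) inv; apply/negP => sc; apply: inv.
apply/invertible_opp/(@coercive_invertible _ _ _ (s - c)).
- have := bop_scale (-1) (bop_shift s bX).
  by congr bounded_operator; apply/funext => u; rewrite rsNl rs1.
- by move=> u v; rewrite /op_shift !ipE sX.
- by rewrite subr_gt0.
- by move=> u; rewrite /op_shift !ipE mulrBl opprB lerD2l lerN2.
Qed.

(** The bound is kept at least [1] so that powers of [M] increase with the exponent in later
    estimates. *)
Lemma real_spectrum_itv X : bounded_operator X -> symmetric_op X -> nonneg_op X ->
  exists2 M : R, 1 <= M & forall s, real_spectrum X s -> 0 <= s <= M.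
Proof.
move=> bX sX nX; have [M M0 hM] := bop_bound bX.
exists (M + 1) => [|s Ss]; first by rewrite lerDr ltW.
rewrite (real_spectrum_ge bX sX _ Ss) => [/=|u]; last by rewrite mul0r.
apply: (real_spectrum_le bX sX _ Ss) => u.
apply: le_trans (ip_le _ _) _; rewrite -hnorm_sqr expr2 mulrA.
apply: ler_wpM2r; first exact: hnorm_ge0.
apply: le_trans (hM u) _; apply: ler_wpM2r; first exact: hnorm_ge0.
by rewrite lerDl.
Qed.

End RealSpectrum.

(** * Real powers as functions of base and exponent; bisection *)

Section RealPowers.
Variable R : realType.
Implicit Types (s t a b M : R).

Lemma powR_within (A : set R) t : 0 <= t -> (forall s, A s -> 0 <= s) ->
  {within A, continuous (fun s => s `^ t)}.
Proof.
rewrite le_eqVlt => /predU1P[<- _|t0 A0].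
  by under eq_fun do rewrite powRr0; move=> x; exact: cvg_cst.
apply/subspace_continuousP => x Ax; rewrite /from_subspace.
have := A0 _ Ax; rewrite le_eqVlt => /predU1P[<-|x0].
  rewrite /= powR0 ?gt_eqF//; apply/cvgrPdist_lt => e e0.
  apply/nbhs_ballP; exists (e `^ t^-1) => /=; first exact: powR_gt0.
  move=> y; rewrite /ball /= !sub0r !normrN => ye Ay.
  rewrite (ger0_norm (powR_ge0 _ _)) -[ltRHS](powRr1 (ltW e0)) -(mulVf (lt0r_neq0 t0)).
  rewrite powRrM gt0_ltr_powR ?nnegrE ?powR_ge0 ?A0//.
  by move: ye; rewrite ger0_norm ?A0.
have dx : derivable (fun y : R => y `^ t) x 1.
  by apply: derivable_powR; rewrite in_itv /= andbT.
by move/derivable1_diffP/differentiable_continuous: dx; exact: cvg_within_filter.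
Qed.

Lemma powR_mid s a b : 0 < a -> 0 <= b ->
  s `^ ((a + b) / 2) = Num.sqrt (s `^ a * s `^ b).
Proof.
move=> a0 b0; rewrite -powRD; last by rewrite gt_eqF ?ltr_pwDl.
by rewrite -powR12_sqrt ?powR_ge0// -powRrM.
Qed.

(* Small [s]: [y exp(-a y) <= 1/a]; large [s]: [1 - exp(-x) <= x]. *)
Lemma powR_lipschitz a b M : 0 < a -> 1 <= M -> exists K : R, forall s t t',
  0 <= s <= M -> a <= t <= b -> a <= t' <= b ->
  `|s `^ t - s `^ t'| <= K * `|t - t'|.
Proof.
move=> a0 M1; exists (a^-1 + M `^ b * M) => s t t'.
wlog tt' : t t' / t <= t'.
  by move=> wl hs ht ht'; case: (leP t t') => [|/ltW] h;
    [|rewrite distrC [`|t - _|]distrC]; exact: wl.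
move=> /andP[s0 sM] /andP[at1 tb] /andP[at' tb'].
rewrite [`|t - t'|]distrC (ger0_norm (_ : 0 <= t' - t)) ?subr_ge0//.
set d := t' - t; have d0 : 0 <= d by rewrite subr_ge0.
have K1 : 0 <= a^-1 by rewrite invr_ge0 ltW.
have K2 : 0 <= M `^ b * M by rewrite mulr_ge0 ?powR_ge0// (le_trans ler01).
have [->|sn0] := eqVneq s 0.
  have t_gt0 := lt_le_trans a0 at1; have t'_gt0 := lt_le_trans a0 at'.
  by rewrite !powR0 ?lt0r_neq0// subrr normr0 (mulr_ge0 (addr_ge0 K1 K2)).
have sgt : 0 < s by rewrite lt_neqAle eq_sym sn0.
have split1 : s `^ t' = s `^ t * s `^ d by rewrite -powRD ?sn0 ?implybT// /d addrC subrK.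
have split2 : s `^ t = s `^ t' * s `^ (- d) by rewrite -powRD ?sn0 ?implybT// /d opprB addrC subrK.
have dE x : s `^ x = expR (x * ln s) by rewrite /powR (negbTE sn0).
clearbody d; have [s1|s1] := leP s 1.
  rewrite ger0_norm ?subr_ge0; last by apply: ger_powR; rewrite ?sgt.
  have sd : 1 - s `^ d <= d * (- ln s).
    by rewrite dE; have := expR_ge1Dx (d * ln s); lra.
  have sa : s `^ a * (- ln s) <= a^-1.
    rewrite dE; have := expR_ge1Dx (a * - ln s).
    rewrite -(ler_pM2l (expR_gt0 (a * ln s))) -expRD mulrN subrr expR0 => h.
    rewrite -(ler_pM2l a0) divff ?gt_eqF// mulrCA; apply: le_trans h.
    by rewrite mulrN ler_wpM2l ?expR_ge0// lerDr.
  have ln0 : 0 <= - ln s by rewrite oppr_ge0 ln_le0.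
  rewrite split1 -[X in X - _]mulr1 -mulrBr.
  apply: (@le_trans _ _ (s `^ a * (d * - ln s))).
    apply: ler_pM; rewrite ?powR_ge0 ?subr_ge0//; last by apply: ger_powR; rewrite ?sgt.
    by rewrite -(powRr0 s); apply: ger_powR; rewrite ?sgt.
  rewrite mulrCA mulrDl [a^-1 * d]mulrC -[leLHS]addr0.
  by apply: lerD; [exact: ler_wpM2l|exact: mulr_ge0].
rewrite distrC ger0_norm ?subr_ge0; last by apply: ler_powR => //; exact: ltW.
rewrite split2 -[X in X - _]mulr1 -mulrBr mulrDl -[leLHS]add0r.
apply: lerD; first exact: mulr_ge0.
rewrite -mulrA; apply: ler_pM; rewrite ?powR_ge0//.
- by rewrite subr_ge0 -(powRr0 s); apply: ler_powR; [exact: ltW|rewrite oppr_le0].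
- apply: (@le_trans _ _ (M `^ t')); last exact: ler_powR.
  by apply: ge0_ler_powR; rewrite ?nnegrE ?(le_trans _ at') ?(ltW a0)// (le_trans ler01).
- rewrite dE; have := expR_ge1Dx (- d * ln s).
  have : ln s <= M by apply: le_trans sM; exact/ltW/ln_sublinear.
  move=> h1 h2; apply: (@le_trans _ _ (d * ln s)); first by lra.
  by rewrite [leRHS]mulrC; exact: ler_wpM2l.
Qed.

(** Bisection keeps both endpoints in [E] and traps [x] between them at distance [(b - a) / 2^n], so
    [x] is a limit of points of [E]. *)
Lemma midpoint_closed_itv (E : R -> Prop) a b : E a -> E b ->
  (forall x y, a <= x <= b -> a <= y <= b -> E x -> E y -> E ((x + y) / 2)) ->
  (forall x, a <= x <= b ->
    (forall e, 0 < e -> exists2 y, a <= y <= b & E y /\ `|x - y| < e) -> E x) ->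
  forall x, a <= x <= b -> E x.
Proof.
move=> Ea Eb Emid Ecl x /andP[ax xb].
have bisect n : exists l r, [/\ E l, E r, a <= l <= x, x <= r <= b &
    r - l = (b - a) / 2 ^+ n].
  elim: n => [|n [l [r [El Er /andP[al lx] /andP[xr rb] rl]]]].
    by exists a, b; rewrite expr0 divr1 lexx ax xb lexx.
  have Em : E ((l + r) / 2).
    by apply: Emid => //; apply/andP; split; lra.
  have h : (r - l) / 2 = (b - a) / 2 ^+ n.+1 by rewrite rl exprS invfM; ring.
  case: (leP ((l + r) / 2) x) => hm.
    exists ((l + r) / 2), r; split=> //; first by apply/andP; split; lra.
      by rewrite xr rb.
    by rewrite -h; field.
  exists l, ((l + r) / 2); split=> //; first by rewrite al lx.
    by apply/andP; split; lra.
  by rewrite -h; field.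
apply: Ecl => [|e e0]; first by rewrite ax xb.
have [N hN] : exists N : nat, (b - a) / 2 ^+ N < e.
  exists (Num.bound ((b - a) / e)); rewrite ltr_pdivrMr ?exprn_gt0// mulrC -ltr_pdivrMr//.
  apply: lt_le_trans (archi_boundP _) _.
    by rewrite divr_ge0 ?(ltW e0)// subr_ge0 (le_trans ax).
  by rewrite -natrX ler_nat ltnW // ltn_expl.
have [l [r [El _ /andP[al lx] /andP[xr _] rl]]] := bisect N.
exists l; first by rewrite al (le_trans lx).
by split=> //; rewrite ger0_norm ?subr_ge0//; apply: le_lt_trans hN; rewrite -rl lerB.
Qed.

End RealPowers.

(** * Operations on functions continuous on a set *)

Section WithinContinuity.
Variables (R : realType) (A : set R).
Implicit Types (f g : R -> R).

Lemma within_cst (r : R) : {within A, continuous (fun=> r)}.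
Proof. by move=> x; exact: cvg_cst. Qed.

Lemma within_id : {within A, continuous (@id R)}.
Proof. by apply: continuous_subspaceT => x; exact: cvg_id. Qed.

Lemma within_add f g : {within A, continuous f} -> {within A, continuous g} ->
  {within A, continuous (fun s => f s + g s)}.
Proof. by move=> cf cg x; apply: cvgD; [exact: cf|exact: cg]. Qed.

Lemma within_mul f g : {within A, continuous f} -> {within A, continuous g} ->
  {within A, continuous (fun s => f s * g s)}.
Proof. by move=> cf cg x; apply: cvgM; [exact: cf|exact: cg]. Qed.

Lemma within_scale (r : R) f : {within A, continuous f} ->
  {within A, continuous (fun s => r * f s)}.
Proof. by move=> cf; apply: (@within_mul (fun=> r)) => //; exact: within_cst. Qed.

Lemma within_sqrt f : {within A, continuous f} ->
  {within A, continuous (fun s => Num.sqrt (f s))}.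
Proof.
move=> cf x; apply: (@continuous_comp (subspace A) R R f Num.sqrt x); first exact: cf.
exact: sqrt_continuous.
Qed.

Lemma within_inv f : {within A, continuous f} -> (forall s, A s -> f s != 0) ->
  {within A, continuous (fun s => (f s)^-1)}.
Proof.
move=> /subspace_continuousP cf f0; apply/subspace_continuousP => x Ax.
by apply: cvgV; [exact: f0|exact: cf].
Qed.

Lemma within_eq f g : (forall s, A s -> f s = g s) ->
  {within A, continuous f} -> {within A, continuous g}.
Proof.
move=> fg cf; apply: subspace_eq_continuous cf => x.
by rewrite inE; exact: fg.
Qed.

End WithinContinuity.
Arguments within_scale {R A} r {f}.

(** * Consequences of the axioms of a continuous calculus *)

Section Calculus.
Variables (R : realType) (H : rightQuatHilbertType R) (X : H -> H).
Variable Phi : (R -> R) -> H -> H.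
Hypothesis calc : is_continuous_calculus X Phi.
Let A := real_spectrum X.
Implicit Types (f g : R -> R) (u v : H) (s t : R).

Lemma calc_diff : exists2 C : R, 0 < C &
  forall f g e, {within A, continuous f} -> {within A, continuous g} -> 0 <= e ->
    (forall s, A s -> `|f s - g s| <= e) ->
    forall u, hnorm (Phi f u - Phi g u) <= C * e * hnorm u.
Proof.
have [C hC] := calc_continuous calc; exists (`|C| + 1); first by rewrite ltr_wpDl.
move=> f g e cf cg e0 fge u.
have -> : Phi f u - Phi g u = Phi (fun s => f s + (-1) * g s) u.
  rewrite (calcD calc cf (within_scale (-1) cg)) (calcZ calc _ cg).
  by rewrite -/(rs _ _) rsNl rs1.
apply: le_trans (hC _ e _ e0 _ u) _.
- exact/within_add/within_scale.
- by move=> s As; rewrite mulN1r; exact: fge.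
- by do 2 (apply: ler_wpM2r; rewrite ?hnorm_ge0//); rewrite (le_trans (ler_norm C))// lerDl.
Qed.

Lemma calc_add f g u : {within A, continuous f} -> {within A, continuous g} ->
  Phi (fun s => f s + g s) u = Phi f u + Phi g u.
Proof. by move=> cf cg; rewrite (calcD calc). Qed.

Lemma calc_scale r f u : {within A, continuous f} ->
  Phi (fun s => r * f s) u = rs r (Phi f u).
Proof. by move=> cf; rewrite (calcZ calc). Qed.

Lemma calc_mul f g u : {within A, continuous f} -> {within A, continuous g} ->
  Phi (fun s => f s * g s) u = Phi f (Phi g u).
Proof. by move=> cf cg; rewrite (calcM calc). Qed.

Lemma calc_comm f g u : {within A, continuous f} -> {within A, continuous g} ->
  Phi f (Phi g u) = Phi g (Phi f u).
Proof.
by move=> cf cg; rewrite -!calc_mul//; congr (Phi _ _); apply/funext => s; rewrite mulrC.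
Qed.

Lemma calc_shift f r u : {within A, continuous f} ->
  Phi (fun s => f s + r) u = Phi f u + rs r u.
Proof.
move=> cf; have -> : (fun s => f s + r) = (fun s => f s + r * 1).
  by apply/funext => s; rewrite mulr1.
rewrite calc_add ?calc_scale ?calc1//; [|exact: within_cst|exact/within_scale/within_cst].
by rewrite (calc1 calc).
Qed.

(** The pointwise reciprocal is continuous on the spectrum, and [calc_ext] ignores what happens
    elsewhere. *)
Lemma calc_right_inverse f : {within A, continuous f} ->
  (forall s, A s -> f s != 0) -> exists W : H -> H, forall u, Phi f (W u) = u.
Proof.
move=> cf f0; have cV := within_inv cf f0.
exists (Phi (fun s => (f s)^-1)) => u; rewrite -calc_mul//.
rewrite (calc_ext calc (g := fun=> 1)) ?(calc1 calc)//.
- exact: within_mul.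
- exact: within_cst.
- by move=> s As; rewrite divff ?f0.
Qed.

Lemma calc_symmetric_limit f : {within A, continuous f} ->
  (forall e, 0 < e -> exists g, [/\ {within A, continuous g}, symmetric_op (Phi g)
     & forall s, A s -> `|f s - g s| <= e]) -> symmetric_op (Phi f).
Proof.
move=> cf app u v; have [C C0 hC] := calc_diff.
apply/eqP; rewrite -subr_eq0 -normr_le0; apply/ler_addgt0Pl => e e0; rewrite addr0.
(* Replacing [f] by [g] on both sides costs at most [2 C (e / k) |u| |v| = e (k - 1) / k]; the [+ 1]
   keeps [k] positive when [u] or [v] is [0]. *)
pose k := 2 * C * (hnorm u * hnorm v) + 1.
have k0 : 0 < k by rewrite ltr_wpDl ?mulr_ge0 ?hnorm_ge0 ?ltW.
have [g [cg sg fg]] := app (e / k) (divr_gt0 e0 k0).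
have ek0 : 0 <= e / k by rewrite ltW ?divr_gt0.
have hu := hC _ _ _ cf cg ek0 fg u; have hv := hC _ _ _ cf cg ek0 fg v.
have -> : ip (Phi f u) v - ip u (Phi f v) =
    ip (Phi f u - Phi g u) v - ip u (Phi f v - Phi g v).
  by rewrite !ipE sg; ring.
have bd (x y : H) : `|ip x y| <= hnorm x * hnorm y.
  by rewrite ler_norml lerNl -ipNl -{1}(hnormN x) !ip_le.
apply: le_trans (ler_normB _ _) _.
apply: (@le_trans _ _ (C * (e / k) * hnorm u * hnorm v + hnorm u * (C * (e / k) * hnorm v))).
  apply: lerD; apply: le_trans (bd _ _) _.
    by apply: ler_wpM2r hu; exact: hnorm_ge0.
  by apply: ler_wpM2l hv; exact: hnorm_ge0.
have -> : C * (e / k) * hnorm u * hnorm v + hnorm u * (C * (e / k) * hnorm v)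
  = e * ((k - 1) / k) by rewrite /k; field; exact: lt0r_neq0.
by rewrite ler_piMr ?ltW// ltr_pdivrMr// mul1r; lra.
Qed.

(* The polynomials [p_(n+1) = p_n + (f - p_n^2)/(2m)] increase to [sqrt f]. *)
Lemma calc_symmetric_sqrt f (m : R) : {within A, continuous f} -> 0 < m ->
  (forall s, A s -> 0 <= f s <= m ^+ 2) -> symmetric_op (Phi f) ->
  symmetric_op (Phi (fun s => Num.sqrt (f s))).
Proof.
move=> cf m0 fm sf.
pose p := fix p n : R -> R := if n is k.+1 then
  fun s => p k s + (2 * m)^-1 * (f s + (-1) * (p k s * p k s)) else fun=> 0.
have cp n : {within A, continuous (p n)}.
  elim: n => [|n IH] /=; first exact: within_cst.
  by apply: within_add => //; apply/within_scale/within_add => //; exact/within_scale/within_mul.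
have sp n : symmetric_op (Phi (p n)).
  elim: n => [|n IH] /= u v.
    have -> : (fun=> 0 : R) = (fun s => 0 * f s) by apply/funext => s; rewrite mul0r.
    by rewrite !calc_scale// !rs0 ip0l ip0r.
  have c1 := within_mul (cp n) (cp n); have c2 := within_scale (-1) c1.
  have c3 := within_add cf c2; have c4 := within_scale (2 * m)^-1 c3.
  rewrite !(calc_add _ _ c4)// !calc_scale// !calc_add// !calc_scale// !calc_mul//.
  by rewrite !ipE IH sf !IH.
(* The third bound is a rate: with [q = sqrt (f s)] it gives [q - p_n <= 2 m / n], uniformly on the
   spectrum. Each step multiplies the error by at most [1 - q / (2 m)], and [(1 - q / (2 m)) (2 m +
   (n + 1) q) <= 2 m + n q] carries the induction. *)
have est n s : A s -> [/\ 0 <= p n s, p n s <= Num.sqrt (f s) &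
    (Num.sqrt (f s) - p n s) * (2 * m + n%:R * Num.sqrt (f s)) <= 2 * m * Num.sqrt (f s)].
  move=> As; have /andP[f0 fm2] := fm s As.
  set q := Num.sqrt (f s); have q0 : 0 <= q by exact: sqrtr_ge0.
  have qq : f s = q ^+ 2 by rewrite sqr_sqrtr.
  have qm : q <= m by rewrite -(ger0_norm (ltW m0)) -sqrtr_sqr ler_sqrt ?sqr_ge0.
  have mi : 0 < (2 * m)^-1 by rewrite invr_gt0 mulr_gt0.
  elim: n => [|n [p0 pq IH]] /=; first by split=> //; rewrite subr0 mul0r addr0 mulrC.
  set x := p n s in p0 pq IH *; rewrite qq.
  have E1 : q - (x + (2 * m)^-1 * (q ^+ 2 + -1 * (x * x))) =
      (q - x) * (1 - (2 * m)^-1 * (q + x)) by ring.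
  have l1 : (2 * m)^-1 * (q + x) <= 1.
    by rewrite ler_pdivrMl ?mulr_gt0// mulr1; lra.
  have l2 : (2 * m)^-1 * q <= (2 * m)^-1 * (q + x) by rewrite ler_pM2l// lerDl.
  split.
  - by rewrite addr_ge0// mulr_ge0 ?(ltW mi)// mulN1r subr_ge0 expr2 ler_pM.
  - by rewrite -subr_ge0 E1 mulr_ge0 ?subr_ge0.
  rewrite E1 -mulrA; apply: le_trans IH; apply: ler_wpM2l; first by rewrite subr_ge0.
  have n0 : 0 <= n%:R :> R by [].
  apply: (@le_trans _ _ ((1 - (2 * m)^-1 * q) * (2 * m + n.+1%:R * q))).
    by apply: ler_wpM2r; [rewrite addr_ge0 ?mulr_ge0 ?(ltW m0)//|rewrite lerB].
  rewrite -[n.+1%:R]natr1.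
  have -> : (1 - (2 * m)^-1 * q) * (2 * m + (n%:R + 1) * q) =
    2 * m + n%:R * q - (2 * m)^-1 * (n%:R + 1) * q ^+ 2 by field; exact: lt0r_neq0.
  by rewrite gerBl mulr_ge0 ?sqr_ge0// mulr_ge0 ?(ltW mi)// addr_ge0.
apply: calc_symmetric_limit => [|e e0]; first exact: within_sqrt.
have [d [d0 dsmall]] := vanishing_seq R.
pose N := Num.bound (2 * m / e).
exists (p N); split=> // s As; have [p0 pq hN] := est N s As.
rewrite ger0_norm ?subr_ge0//.
have [q0|qn] := eqVneq (Num.sqrt (f s)) 0.
  by rewrite q0 sub0r (le_trans _ (ltW e0))// oppr_le0.
have q0 : 0 < Num.sqrt (f s) by rewrite lt_neqAle eq_sym qn sqrtr_ge0.
have N0 : 2 * m / e < N%:R by apply: archi_boundP; rewrite divr_ge0 ?mulr_ge0 ?ltW.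
have Npos : 0 < N%:R :> R by apply: le_lt_trans N0; rewrite divr_ge0 ?mulr_ge0 ?ltW.
have h : (Num.sqrt (f s) - p N s) * N%:R <= 2 * m.
  rewrite -(ler_pM2r q0) -mulrA; apply: le_trans hN; apply: ler_wpM2l; first by rewrite subr_ge0.
  by rewrite lerDr mulr_ge0 ?ltW.
rewrite -(ler_pM2r Npos); apply: le_trans h _.
by move: N0; rewrite ltr_pdivrMr// [_ * e]mulrC => /ltW.
Qed.

End Calculus.

(** * Powers of a nonnegative operator *)

Section CalculusPowers.
Variables (R : realType) (H : rightQuatHilbertType R) (X : H -> H).
Variable Phi : (R -> R) -> H -> H.
Hypothesis calc : is_continuous_calculus X Phi.
Hypotheses (bX : bounded_operator X) (sX : symmetric_op X) (nX : nonneg_op X).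
Implicit Types (u v : H) (s t : R).

(** At [F = fcalc X] this is [opow X]. With [F] a parameter the results hold for every calculus, so
    uniqueness never has to be discussed. *)
Definition calc_pow (F : (R -> R) -> H -> H) t := F (fun s => s `^ t).

Let pw := calc_pow Phi.

Lemma spectrum_ge0 s : real_spectrum X s -> 0 <= s.
Proof. by have [M _ h] := real_spectrum_itv bX sX nX => /h/andP[]. Qed.

Lemma pow_within t : 0 <= t -> {within real_spectrum X, continuous (fun s => s `^ t)}.
Proof. by move=> t0; apply: powR_within => // s; exact: spectrum_ge0. Qed.

Lemma pow_bounded t : 0 <= t -> bounded_operator (pw t).
Proof. by move=> t0; apply: (calc_bounded calc); exact: pow_within. Qed.

Lemma powD a b u : 0 < a -> 0 < b -> pw (a + b) u = pw a (pw b u).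
Proof.
move=> a0 b0; rewrite /pw /calc_pow -(calc_mul calc); try exact/pow_within/ltW.
by congr (Phi _ _); apply/funext => s; rewrite powRD// gt_eqF ?addr_gt0.
Qed.

Lemma pow_half t u : 0 < t -> pw (t / 2) (pw (t / 2) u) = pw t u.
Proof. by move=> t0; rewrite -powD ?divr_gt0// -splitr. Qed.

Lemma pow1 : pw 1 = X.
Proof.
rewrite -[RHS](calc_id calc); apply: (calc_ext calc).
- exact: pow_within.
- exact: within_id.
- by move=> s /spectrum_ge0; exact: powRr1.
Qed.

Lemma pow_sqrtK u : pw 2^-1 (pw 2^-1 u) = X u.
Proof. by have := pow_half u ltr01; rewrite div1r pow1. Qed.

Lemma pow0 : pw 0 = id.
Proof.
by rewrite -(calc1 calc) /pw /calc_pow; congr Phi; apply/funext => s; rewrite powRr0.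
Qed.

Lemma pow_continuous a b : 0 < a -> exists2 K : R, 0 < K &
  forall t t' u, a <= t <= b -> a <= t' <= b ->
    hnorm (pw t u - pw t' u) <= K * `|t - t'| * hnorm u.
Proof.
move=> a0; have [M M1 hM] := real_spectrum_itv bX sX nX.
have [K hK] := powR_lipschitz b a0 M1; have [C C0 hC] := calc_diff calc.
exists (C * (`|K| + 1)); first by rewrite mulr_gt0// ltr_wpDl.
move=> t t' u ht ht'; rewrite -[C * _ * _]mulrA; apply: hC.
- by apply: pow_within; case/andP: ht => at1 _; rewrite (le_trans (ltW a0)).
- by apply: pow_within; case/andP: ht' => at1 _; rewrite (le_trans (ltW a0)).
- by rewrite mulr_ge0.
- move=> s /hM hs; apply: le_trans (hK _ _ _ hs ht ht') _; apply: ler_wpM2r => //.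
  by rewrite (le_trans (ler_norm K))// lerDl.
Qed.

(** The power in question is the square root of [X^a X^b], a product that is symmetric because its
    factors commute. Allowing [b = 0] makes halving an exponent a special case. *)
Lemma pow_mid_symmetric a b : 0 < a <= 1 -> 0 <= b <= 1 ->
  symmetric_op (pw a) -> symmetric_op (pw b) -> symmetric_op (pw ((a + b) / 2)).
Proof.
move=> /andP[a0 a1] /andP[b0 b1] sa sb; have [M M1 hM] := real_spectrum_itv bX sX nX.
have M0 := lt_le_trans ltr01 M1.
rewrite /pw /calc_pow; under eq_fun do rewrite powR_mid//.
have ca := pow_within (ltW a0); have cb := pow_within b0.
apply: (calc_symmetric_sqrt calc _ M0); first exact: within_mul.
  move=> s /hM/andP[s0 sM]; rewrite mulr_ge0 ?powR_ge0//= expr2.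
  have le1 t : 0 <= t -> t <= 1 -> s `^ t <= M.
    move=> t0 t1; apply: (@le_trans _ _ (M `^ t)); last first.
      by rewrite -[leRHS](powRr1 (ltW M0)); exact: ler_powR.
    by rewrite ge0_ler_powR ?nnegrE// ltW.
  by apply: ler_pM; rewrite ?powR_ge0 ?le1 ?(ltW a0).
by move=> u v; rewrite !(calc_mul calc)// sa sb -(calc_comm calc).
Qed.

Lemma pow_symmetric t : 0 < t <= 1 -> symmetric_op (pw t).
Proof.
move=> /andP[t0 t1].
have dyadic n : symmetric_op (pw (2 ^- n)).
  elim: n => [|n IH]; first by rewrite expr0 invr1 pow1.
  have -> : 2 ^- n.+1 = (2 ^- n + 0) / 2 :> R by rewrite addr0 exprSr invfM mulrC.
  have h0 : 0 < 2 ^- n :> R by rewrite invr_gt0 exprn_gt0.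
  have h1 : 2 ^- n <= 1 :> R by rewrite invf_le1 ?exprn_gt0// exprn_ege1// ler1n.
  by apply: pow_mid_symmetric; rewrite ?h0 ?h1 ?lexx ?ler01// pow0.
(* [powR_lipschitz] is uniform only for exponents bounded away from [0], so the bisection runs on
   [[2^-n, 1]]. *)
have [n hn] : exists n : nat, 2 ^- n <= t.
  exists (Num.bound t^-1); rewrite invf_ple ?posrE ?exprn_gt0//.
  apply: ltW; apply: lt_le_trans (archi_boundP _) _; first by rewrite invr_ge0 ltW.
  by rewrite -natrX ler_nat ltnW// ltn_expl.
have n0 : 0 < 2 ^- n :> R by rewrite invr_gt0 exprn_gt0.
apply: (@midpoint_closed_itv R (fun t => symmetric_op (pw t)) (2 ^- n) 1 (dyadic n) _ _ _ t).
- by rewrite pow1.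
- move=> x y /andP[x0 x1] /andP[y0 y1] ex ey.
  apply: pow_mid_symmetric => //; apply/andP; split=> //.
    exact: lt_le_trans n0 _.
  by rewrite ltW// (lt_le_trans n0).
- move=> x hx app.
  have [M M1 hM] := real_spectrum_itv bX sX nX; have [K hK] := powR_lipschitz 1 n0 M1.
  have cw y : 2 ^- n <= y <= 1 -> {within real_spectrum X, continuous (fun s => s `^ y)}.
    by case/andP=> ny _; apply: pow_within; rewrite (le_trans (ltW n0)).
  apply: (calc_symmetric_limit calc) => [|e e0]; first exact: cw.
  have K0 : 0 < `|K| + 1 by rewrite ltr_wpDl.
  have [y hy [ey xy]] := app (e / (`|K| + 1)) (divr_gt0 e0 K0).
  exists (fun s => s `^ y); split=> //; first exact: cw.
  move=> s /hM hs; apply: le_trans (hK _ _ _ hs hx hy) _.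
  move: xy; rewrite ltr_pdivlMr// mulrC => /ltW; apply: le_trans.
  by apply: ler_wpM2r => //; rewrite (le_trans (ler_norm K))// lerDl.
- by rewrite hn t1.
Qed.

Lemma pow_nonneg t : 0 < t <= 1 -> nonneg_op (pw t).
Proof.
move=> /andP[t0 t1] u; rewrite -pow_half// pow_symmetric ?ip_ge0//.
by rewrite divr_gt0//= ler_pdivrMr// mul1r (le_trans t1)// ler1n.
Qed.

End CalculusPowers.

(** * Geometric means and the Loewner-Heinz inequality *)

Section LoewnerHeinz.
Variables (R : realType) (H : rightQuatHilbertType R).
Implicit Types (u v : H) (r s t : R) (D F G X Y : H -> H).

(** [l] is the supremum of the Rayleigh quotient, so [L = l - D] is nonnegative and
    [nonneg_op_bound] gives [|L u|^2 <= N ip (L u) u]. The right side is small once the quotient at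
    [u] is close to the supremum. *)
Lemma approximate_eigenvector D : bounded_operator D -> symmetric_op D ->
  (exists u, 0 < ip (D u) u) -> exists2 l : R, 0 < l &
  forall eta : R, 0 < eta -> exists2 u, u != 0 &
    ip (rs l u - D u) (rs l u - D u) <= eta * ip u u.
Proof.
move=> bD sD [u0 Du0]; have [M M0 hM] := bop_bound bD.
have gt0 u : u != 0 -> 0 < ip u u.
  by move=> un; rewrite lt_neqAle ip_ge0 andbT eq_sym; apply: contra_neq un; exact: ip_eq0.
pose S : set R := [set x | exists2 u, u != 0 & x = ip (D u) u / ip u u].
have u0n : u0 != 0 by apply: contraTneq Du0 => ->; rewrite ip0r ltxx.
have S0 : S (ip (D u0) u0 / ip u0 u0) by exists u0.
have S_sup : has_sup S.
  split; first by eexists; exact: S0.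
  exists M => _ [u un ->]; rewrite ler_pdivrMr ?gt0//.
  apply: le_trans (ip_le _ _) _; rewrite -hnorm_sqr expr2 mulrA.
  by apply: ler_wpM2r (hM u); exact: hnorm_ge0.
have l0 : 0 < sup S.
  by apply: lt_le_trans (ub_le_sup S_sup.2 S0); rewrite divr_gt0 ?gt0.
exists (sup S) => // eta eta0; pose L u := rs (sup S) u - D u.
have bL : bounded_operator L by exact: bop_sub (bop_scale _ (@bop_id _ _)) bD.
have sL : symmetric_op L by move=> u v; rewrite /L !ipE sD.
have nL : nonneg_op L.
  move=> u; have [->|un] := eqVneq u 0; first by rewrite ip0r.
  rewrite /L !ipE subr_ge0 -ler_pdivrMr ?gt0//.
  by apply: ub_le_sup; [exact: S_sup.2 | exists u].
have [N N0 hN] := bop_bound bL; have bd := nonneg_op_bound bL sL nL hN.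
have [_ [u un ->]] := sup_adherent (divr_gt0 eta0 N0) S_sup.
rewrite ltr_pdivlMr ?gt0// => hu; exists u => //; apply: le_trans (bd u) _.
have : ip (L u) u <= eta / N * ip u u by rewrite /L !ipE; move: hu; rewrite mulrBl; lra.
by rewrite -(ler_pM2l N0) => h; apply: le_trans h _; rewrite mulrA mulrCA divff ?lt0r_neq0// mulr1.
Qed.

(* If [D = X Y - F' G'], [F' = F + e], [G' = G + e], had an approximate
   eigenvector [u] with eigenvalue [l > 0], testing against [w = G' F'^-1 u] gives
   [|G' u|^2 + l <u, w> ~ <X Y u, w> = <Y u, X w> <= |G' u| |F' w| = |G' u|^2],
   although [<u, w>] is bounded below. *)
Lemma geometric_mean_le X Y F G :
  bounded_operator X -> bounded_operator Y -> bounded_operator F -> bounded_operator G ->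
  symmetric_op X -> symmetric_op Y -> symmetric_op F -> symmetric_op G ->
  (forall u, X (Y u) = Y (X u)) -> (forall u, F (G u) = G (F u)) ->
  nonneg_op F -> nonneg_op G -> (forall u, 0 <= ip (F u) (G u)) ->
  (forall u, ip (X u) (X u) <= ip (F u) (F u)) ->
  (forall u, ip (Y u) (Y u) <= ip (G u) (G u)) ->
  (forall e, 0 < e -> exists W : H -> H, forall u, F (W u) + rs e (W u) = u) ->
  forall u, ip (X u) (Y u) <= ip (F u) (G u).
Proof.
move=> bX bY bF bG sX sY sF sG XY FG nF nG nFG XF YG inv.
have shifted e : 0 < e -> forall u,
    ip (X u) (Y u) <= ip (F u + rs e u) (G u + rs e u).
  move=> e0; have [W FW] := inv e e0.
  pose F' u := F u + rs e u; pose G' u := G u + rs e u.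
  have bid := bop_scale e (@bop_id R H).
  have bF' : bounded_operator F' by exact: bop_add bF bid.
  have bG' : bounded_operator G' by exact: bop_add bG bid.
  have sF' : symmetric_op F' by move=> u v; rewrite /F' !ipE sF.
  have sG' : symmetric_op G' by move=> u v; rewrite /G' !ipE sG.
  have FG' u : F' (G' u) = G' (F' u).
    by rewrite /F' /G' !(bopE bF) !(bopE bG) FG rsD -!addrA; congr (_ + _); rewrite addrCA -rsD.
  have XF' u : ip (X u) (X u) <= ip (F' u) (F' u).
    apply: le_trans (XF u) _; rewrite /F' !ipE (ipC u); have := nF u; have := ip_ge0 u; nra.
  have YG' u : ip (Y u) (Y u) <= ip (G' u) (G' u).
    apply: le_trans (YG u) _; rewrite /G' !ipE (ipC u); have := nG u; have := ip_ge0 u; nra.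
  have F'E u : F' u = F u + rs e u by [].
  have G'E u : G' u = G u + rs e u by [].
  clearbody F' G'.
  apply: contrapT => /existsNP[u0 /negP]; rewrite -ltNge -F'E -G'E => u0P.
  pose D u := X (Y u) - F' (G' u).
  have bD : bounded_operator D by exact: bop_sub (bop_comp bX bY) (bop_comp bF' bG').
  have sD : symmetric_op D by move=> u v; rewrite /D !ipE sX sY -XY sF' sG' -FG'.
  have D0 : exists u, 0 < ip (D u) u.
    by exists u0; rewrite /D !ipE XY sY sF' ipC [ip (G' _) _]ipC subr_gt0 [ltRHS]ipC.
  have [l l0 eig] := approximate_eigenvector bD sD D0.
  have [Kf Kf0 hKf] := bop_bound bF'; have [Kg Kg0 hKg] := bop_bound bG'.
  have le2 : 0 < l * e ^+ 2 by rewrite mulr_gt0 ?exprn_gt0.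
  have K0 : 0 < 2 * (Kf * Kg) ^+ 2 by rewrite mulr_gt0// exprn_gt0// mulr_gt0.
  (* The precision makes [|r|^2 |w|^2] at most half of [(l e^2 |v|^2)^2], given [|u| <= Kf |v|] and
     [|w| <= Kg |v|]; the lower bound on [ip r w] demands the whole of it. *)
  have [u un hu] := eig ((l * e ^+ 2) ^+ 2 / (2 * (Kf * Kg) ^+ 2)) (divr_gt0 (exprn_gt0 2 le2) K0).
  set r := rs l u - D u in hu; pose v := W u; have F'v : F' v = u by rewrite F'E; exact: FW.
  pose w := G' v.
  have v0 : 0 < ip v v.
    rewrite lt_neqAle ip_ge0 andbT eq_sym; apply: contra_neq un => /ip_eq0 v00.
    by rewrite -F'v v00 (bop0 bF').
  (* Every term in the expansion of [ip (F' v) (G' v)] is nonnegative; the shift contributes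
     [e^2 ip v v]. *)
  have uw : e ^+ 2 * ip v v <= ip u w.
    rewrite -F'v /w F'E G'E !ipE (ipC v); have := nFG v; have := nF v; have := nG v; nra.
  have F'w : F' w = G' u by rewrite /w FG' F'v.
  have key : l * ip u w <= ip r w.
    have -> : ip r w = l * ip u w + ip (G' u) (G' u) - ip (Y u) (X w).
      by rewrite /r /D !ipE sX sF' F'w; ring.
    rewrite -addrA lerDl subr_ge0; apply: le_trans (ip_le _ _) _.
    rewrite -hnorm_sqr expr2; apply: ler_pM; rewrite ?hnorm_ge0//; apply: hnorm_le => //.
    - exact: hnorm_ge0.
    - by rewrite hnorm_sqr.
    - exact: hnorm_ge0.
    - by rewrite hnorm_sqr -F'w.
  have hw : ip w w <= Kg ^+ 2 * ip v v.
    by rewrite -!hnorm_sqr -exprMn ler_sqr ?nnegrE ?mulr_ge0 ?hnorm_ge0 ?(ltW Kg0)//; exact: hKg.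
  have huv : ip u u <= Kf ^+ 2 * ip v v.
    rewrite -!hnorm_sqr -exprMn ler_sqr ?nnegrE ?mulr_ge0 ?hnorm_ge0 ?(ltW Kf0)//.
    by rewrite -F'v; exact: hKf.
  have big : (l * e ^+ 2 * ip v v) ^+ 2 <= ip r r * ip w w.
    apply: le_trans (cauchy_schwarz r w); rewrite ler_sqr ?nnegrE ?(mulr_ge0 (ltW le2) (ltW v0))//.
      by apply: le_trans key; rewrite -mulrA ler_wpM2l// ltW.
    apply: le_trans key; rewrite mulr_ge0 ?(ltW l0)//; apply: le_trans uw.
    by rewrite mulr_ge0 ?sqr_ge0// ltW.
  have : (l * e ^+ 2 * ip v v) ^+ 2 <= (l * e ^+ 2 * ip v v) ^+ 2 / 2.
    apply: le_trans big _.
    have -> : (l * e ^+ 2 * ip v v) ^+ 2 / 2 =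
        ((l * e ^+ 2) ^+ 2 / (2 * (Kf * Kg) ^+ 2) * (Kf ^+ 2 * ip v v)) * (Kg ^+ 2 * ip v v).
      by field; rewrite !lt0r_neq0.
    apply: ler_pM; rewrite ?ip_ge0//; apply: le_trans hu _.
    by apply: ler_wpM2l => //; rewrite divr_ge0 ?sqr_ge0 ?ltW.
  have : 0 < (l * e ^+ 2 * ip v v) ^+ 2 by rewrite exprn_gt0 ?mulr_gt0.
  lra.
move=> u; apply/ler_addgt0Pl => d d0.
(* Removing the shift: for [e <= 1] it raises the right side by at most [e k], hence by at most [d]
   when [e <= d / k]. *)
pose k := ip (F u) u + ip u (G u) + ip u u + 1.
have k1 : 1 <= k.
  by rewrite lerDr !addr_ge0 ?ip_ge0// ipC.
have k0 : 0 < k by exact: lt_le_trans k1.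
pose e := Num.min 1 (d / k).
have e0 : 0 < e by rewrite lt_min ltr01 divr_gt0.
have e1 : e <= 1 by rewrite ge_min lexx.
have ed : e * k <= d by rewrite -ler_pdivlMr// ge_min lexx orbT.
have -> : d + ip (F u) (G u) = ip (F u) (G u) + e * k + (d - e * k) by ring.
apply: le_trans (shifted e e0 u) _.
have -> : ip (F u + rs e u) (G u + rs e u) =
    ip (F u) (G u) + e * k - e * (1 + (1 - e) * ip u u) by rewrite /k !ipE; ring.
have : 0 <= e * (1 + (1 - e) * ip u u).
  by rewrite mulr_ge0 ?(ltW e0)// addr_ge0// mulr_ge0 ?ip_ge0// subr_ge0.
lra.
Qed.

Section OperatorPowers.
Variables (A B : H -> H) (PhiA PhiB : (R -> R) -> H -> H).
Hypotheses (calcA : is_continuous_calculus A PhiA) (calcB : is_continuous_calculus B PhiB).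
Hypotheses (bA : bounded_operator A) (sA : symmetric_op A) (nA : nonneg_op A).
Hypotheses (bB : bounded_operator B) (sB : symmetric_op B) (nB : nonneg_op B).

Local Notation A_ := (calc_pow PhiA).
Local Notation B_ := (calc_pow PhiB).
Let pow_le t := forall u, ip (B_ t u) u <= ip (A_ t u) u.

Let bA_ t : 0 < t -> bounded_operator (A_ t).
Proof. by move=> /ltW; exact: (pow_bounded calcA). Qed.
Let bB_ t : 0 < t -> bounded_operator (B_ t).
Proof. by move=> /ltW; exact: (pow_bounded calcB). Qed.

Let half_itv t : 0 < t <= 1 -> 0 < t / 2 <= 1.
Proof. by move=> /andP[t0 t1]; apply/andP; split; lra. Qed.

(** Rewrites the order relation at [t] as a comparison of norms, the form in which
    [geometric_mean_le] consumes it. *)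
Lemma pow_le_sqr t : 0 < t <= 1 -> pow_le t -> forall u,
  ip (B_ (t / 2) u) (B_ (t / 2) u) <= ip (A_ (t / 2) u) (A_ (t / 2) u).
Proof.
move=> ht le_t u; have ht2 := half_itv ht; have /andP[t0 _] := ht.
rewrite -(pow_symmetric calcA)// -(pow_symmetric calcB)//.
by rewrite (pow_half calcA)// (pow_half calcB).
Qed.

Lemma pow_le_half t : 0 < t <= 1 -> pow_le t -> pow_le (t / 2).
Proof.
move=> ht le_t; have ht2 := half_itv ht; have /andP[t20 _] := ht2.
(* With [X = F = id] the geometric mean inequality becomes monotonicity of the square root. *)
have h := @geometric_mean_le id (B_ (t / 2)) id (A_ (t / 2)).
move=> u; rewrite ipC [leRHS]ipC; apply: h => //; try exact: bop_id.
- exact: bB_.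
- exact: bA_.
- exact: (pow_symmetric calcB).
- exact: (pow_symmetric calcA).
- exact: ip_ge0.
- exact: (pow_nonneg calcA).
- by move=> v; rewrite ipC; exact: (pow_nonneg calcA).
- exact: pow_le_sqr.
- move=> e e0; exists (rs (1 + e)^-1) => v.
  by rewrite -[X in X + _]rs1 -rsDl -rsM divff ?rs1// lt0r_neq0// addr_gt0.
Qed.

Lemma pow_le_mid s t : 0 < s <= 1 -> 0 < t <= 1 -> pow_le s -> pow_le t ->
  pow_le ((s + t) / 2).
Proof.
move=> hs ht le_s le_t; have hs2 := half_itv hs; have ht2 := half_itv ht.
have /andP[s0 _] := hs2; have /andP[t0 _] := ht2.
have hst : 0 < s / 2 + t / 2 <= 1.
  by move: hs ht => /andP[_ s1] /andP[_ t1]; rewrite addr_gt0//=; lra.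
move=> u; rewrite mulrDl (powD calcA)// (powD calcB)//.
rewrite (pow_symmetric calcA)// (pow_symmetric calcB)// ipC [leRHS]ipC.
have wA r : 0 < r -> {within real_spectrum A, continuous (fun x => x `^ r)}.
  by move=> /ltW; exact: (pow_within bA sA nA).
have wB r : 0 < r -> {within real_spectrum B, continuous (fun x => x `^ r)}.
  by move=> /ltW; exact: (pow_within bB sB nB).
apply: (@geometric_mean_le (B_ (s / 2)) (B_ (t / 2)) (A_ (s / 2)) (A_ (t / 2))).
- exact: bB_.
- exact: bB_.
- exact: bA_.
- exact: bA_.
- exact: (pow_symmetric calcB).
- exact: (pow_symmetric calcB).
- exact: (pow_symmetric calcA).
- exact: (pow_symmetric calcA).
- by move=> v; apply: (calc_comm calcB); exact: wB.
- by move=> v; apply: (calc_comm calcA); exact: wA.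
- exact: (pow_nonneg calcA).
- exact: (pow_nonneg calcA).
- move=> v; rewrite -(pow_symmetric calcA)// -(powD calcA)// addrC.
  exact: (pow_nonneg calcA).
- exact: pow_le_sqr.
- exact: pow_le_sqr.
- move=> e e0; have c1 := wA _ s0.
  have ce : {within real_spectrum A, continuous (fun x => x `^ (s / 2) + e)}.
    by apply: (within_add c1); exact: within_cst.
  have [x _|W hW] := calc_right_inverse calcA ce.
    by rewrite lt0r_neq0// ltr_wpDl ?powR_ge0.
  by exists W => v; rewrite -[RHS]hW (calc_shift calcA).
Qed.

Lemma pow_le_closed a b x : 0 < a -> b <= 1 -> a <= x <= b ->
  (forall e, 0 < e -> exists2 y, a <= y <= b & pow_le y /\ `|x - y| < e) -> pow_le x.
Proof.
move=> a0 b1 hx app u.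
have [K K0 hK] := pow_continuous calcA bA sA nA b a0.
have [L L0 hL] := pow_continuous calcB bB sB nB b a0.
apply/ler_addgt0Pl => d d0; pose k := (K + L) * ip u u + 1.
have k0 : 0 < k by rewrite ltr_wpDl// mulr_ge0 ?ip_ge0// ltW ?addr_gt0.
have [y hy [le_y xy]] := app (d / k) (divr_gt0 d0 k0).
have bd (Z Z' : H -> H) (M : R) : 0 < M -> hnorm (Z u - Z' u) <= M * `|x - y| * hnorm u ->
    ip (Z u) u - ip (Z' u) u <= M * `|x - y| * ip u u.
  move=> M0 h; rewrite -ipNl -ipDl; apply: le_trans (ip_le _ _) _.
  by rewrite -hnorm_sqr expr2 mulrA; apply: ler_wpM2r h; exact: hnorm_ge0.
have h1 := bd _ _ _ L0 (hL x y u hx hy).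
have h3 : ip (A_ y u) u - ip (A_ x u) u <= K * `|x - y| * ip u u.
  by apply: bd K0 _; rewrite hnormC; have := hK x y u hx hy; rewrite hnormC.
have h4 : K * `|x - y| * ip u u + L * `|x - y| * ip u u <= d.
  have -> : K * `|x - y| * ip u u + L * `|x - y| * ip u u =
      `|x - y| * k - `|x - y| by rewrite /k; ring.
  by move: xy; rewrite ltr_pdivlMr// => xy; have := normr_ge0 (x - y); lra.
by have := le_y u; lra.
Qed.

(** Continuity in the exponent is only controlled away from [0], so the interval starts at [p / 2],
    where the square root case provides the endpoint. This is enough to reach [1/2] from any [p] in
    [[1/2, 1)]. *)
Theorem loewner_heinz p t : 0 < p <= 1 -> p / 2 <= t <= p -> pow_le p -> pow_le t.
Proof.
move=> hp ht le_p; have /andP[p0 p1] := hp.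
have p20 : 0 < p / 2 by rewrite divr_gt0.
apply: (@midpoint_closed_itv R pow_le (p / 2) p) ht => //.
- exact: pow_le_half.
- move=> x y /andP[px xp] /andP[py yp]; apply: pow_le_mid; apply/andP; split.
  + exact: lt_le_trans px.
  + exact: le_trans p1.
  + exact: lt_le_trans py.
  + exact: le_trans p1.
- by move=> x; exact: pow_le_closed.
Qed.

End OperatorPowers.
End LoewnerHeinz.

(** * Spectra of [S T] and [T S]; coercivity from invertibility *)

Section ProductSpectrum.
Variables (R : realType) (H : rightQuatHilbertType R).
Implicit Types (u v : H) (s c : R) (S T B : H -> H).

(** Jacobson's formula: if [W] inverts [T S - s], then [s^-1 (S W T - 1)] inverts [S T - s]. *)
Lemma invertible_shift_comp S T s : bounded_operator S -> bounded_operator T ->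
  s != 0 -> invertible_operator (op_shift (T \o S) s) ->
  invertible_operator (op_shift (S \o T) s).
Proof.
move=> bS bT s0 [W [bW WK KW]].
have sK u : rs s^-1 (rs s u) = u by rewrite -rsM mulVf ?rs1.
exists (fun u => rs s^-1 (S (W (T u)) - u)); split.
- exact/bop_scale/bop_sub/bop_id/bop_comp/bop_comp.
- move=> u; rewrite -[RHS]sK /op_shift /=; congr rs.
  have := WK (T u); rewrite /op_shift /= !(bopE bT) => ->.
  by rewrite opprB addrC subrK.
- move=> u; have := KW (T u); rewrite /op_shift /= => KWu.
  rewrite (bopZ _ _ bT) (bopZ _ _ bS) -!rsM [s * _]mulrC rsM -rsB -[RHS]sK; congr rs.
  rewrite !(bopE bT) !(bopE bS) rsD rsN.
  have -> : T (S (W (T u))) = T u + rs s (W (T u)) by rewrite -{2}KWu subrK.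
  rewrite !(bopE bS) opprD opprK [X in X - _]addrC !addrA.
  by rewrite addrAC -[rs s (S _) + _ - _]addrA subrr addr0 [_ - rs s _]addrC addrA addNr add0r.
Qed.

(** If the inverse is bounded by [K] and [B] by [M], then
    [|u|^2 <= K^2 |B u|^2 <= K^2 M ip (B u) u]. *)
Lemma invertible_coercive B : bounded_operator B -> symmetric_op B -> nonneg_op B ->
  invertible_operator B -> exists2 c : R, 0 < c & forall u, c * ip u u <= ip (B u) u.
Proof.
move=> bB sB nB [W [bW WK _]].
have [M M0 hM] := bop_bound bB; have [K K0 hK] := bop_bound bW.
have MK : 0 < K ^+ 2 * M by rewrite mulr_gt0 ?exprn_gt0.
exists (K ^+ 2 * M)^-1 => [|u]; first by rewrite invr_gt0.
rewrite ler_pdivrMl// -mulrA.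
apply: le_trans (_ : K ^+ 2 * ip (B u) (B u) <= _).
  rewrite -!hnorm_sqr -exprMn ler_sqr ?nnegrE ?mulr_ge0 ?hnorm_ge0 ?(ltW K0)//.
  by rewrite -{1}(WK u).
by rewrite ler_wpM2l ?sqr_ge0// nonneg_op_bound.
Qed.

End ProductSpectrum.

(** * Partial isometry identities and the calculus of [T T*] *)

Section PolarTransfer.
Variables (R : realType) (H : rightQuatHilbertType R).
Variables (T S U V P : H -> H).
Hypotheses (bT : bounded_operator T) (bS : bounded_operator S) (bU : bounded_operator U)
  (bV : bounded_operator V) (bP : bounded_operator P) (sP : symmetric_op P).
Hypotheses (aS : forall u v, ip (S u) v = ip u (T v))
  (aV : forall u v, ip (V u) v = ip u (U v)).
Hypotheses (TE : forall u, T u = U (P u)) (PP : forall u, P (P u) = S (T u)).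
Hypothesis kerU : forall u, P u = 0 -> U u = 0.
Implicit Types (u v : H) (s : R) (f g : R -> R).

Lemma adjoint_polar u : S u = P (V u).
Proof. by apply: ip_ext => v; rewrite aS TE -aV sP. Qed.

(** The discrepancy [z] lies in the kernel of [P], since [P V U P = S T = P^2]. Hence [U z = 0], and
    moving [V] and [P] across the inner product gives [ip z z = 0]. *)
Lemma initial_projection_modulus u : V (U (P u)) = P u.
Proof.
apply/eqP; rewrite -subr_eq0; apply/eqP; set z := _ - _; apply: ip_eq0.
have Pz : P z = 0 by rewrite (bopB _ _ bP) -adjoint_polar -TE PP subrr.
by rewrite {1}/z ipDl ipNl aV (kerU Pz) ip0r sP Pz ip0r subrr.
Qed.

Lemma modulus_initial_projection u : P (V (U u)) = P u.
Proof.
by apply: ip_ext => v; rewrite sP aV -[LHS]ipC -aV initial_projection_modulus ipC sP.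
Qed.

(** [V U u - u] lies in the kernel of [P], which [U] annihilates. *)
Lemma partial_isometryK u : U (V (U u)) = U u.
Proof.
apply/eqP; rewrite -subr_eq0 -(bopB _ _ bU); apply/eqP/kerU.
by rewrite (bopB _ _ bP) modulus_initial_projection subrr.
Qed.

Lemma adjoint_partial_isometryK u : V (U (V u)) = V u.
Proof.
by apply: ip_ext => v; rewrite !aV -[LHS]ipC -aV ipC aV partial_isometryK.
Qed.

Let A := S \o T.
Let B := T \o S.

Let bB : bounded_operator B. Proof. exact: bop_comp. Qed.
Let bA : bounded_operator A. Proof. exact: bop_comp. Qed.
Let sB : symmetric_op B.
Proof. by move=> u v; rewrite /B /= ipC -aS ipC aS. Qed.
Let nB : nonneg_op B. Proof. by move=> u; rewrite /B /= ipC -aS ip_ge0. Qed.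

Lemma ker_square u : A u = 0 -> U u = 0.
Proof. by move=> Au; apply: kerU; apply: ip_eq0; rewrite sP PP -[S (T u)]/(A u) Au ip0r. Qed.

Lemma spectrum_swap s : s != 0 -> real_spectrum A s -> real_spectrum B s.
Proof.
move=> s0 /(real_spectrumP _ bA) As; apply/(real_spectrumP _ bB) => Bs; apply: As.
exact: invertible_shift_comp.
Qed.

(* By [spectrum_swap], on the spectrum of [A] this modifies at most the value
   at [0]. *)
Definition restrict0 f s : R := if `[< real_spectrum B s >] then f s else 0.

Lemma restrict0_in f s : real_spectrum B s -> restrict0 f s = f s.
Proof. by move=> Bs; rewrite /restrict0 asboolT. Qed.

Lemma restrict0_out f s : ~ real_spectrum B s -> restrict0 f s = 0.
Proof. by move=> Bs; rewrite /restrict0 asboolF. Qed.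

(** An invertible [B] is coercive, so its spectrum lies above some [c > 0], and nonzero spectral
    points of [A] belong to [B]. *)
Lemma spectrum_gap : ~ real_spectrum B 0 -> invertible_operator B /\
  exists2 c : R, 0 < c & forall s, real_spectrum A s -> s = 0 \/ c <= s.
Proof.
move=> B0; have iB : invertible_operator B.
  apply: contrapT => iB; apply: B0; apply/(real_spectrumP _ bB).
  by have -> : op_shift B 0 = B by apply/funext => u; rewrite /op_shift rs0 subr0.
split=> //; have [c c0 hc] := invertible_coercive bB sB nB iB.
exists c => // s As; have [->|s0] := eqVneq s 0; [by left|right].
exact: real_spectrum_ge bB sB hc (spectrum_swap s0 As).
Qed.

(** If [0] is in the spectrum of [B], the spectrum of [A] is contained in that of [B]. Otherwise
    [spectrum_gap] isolates [0] from the rest of the spectrum of [A], so the value imposed there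
    cannot break continuity. *)
Lemma restrict0_within f : {within real_spectrum B, continuous f} ->
  {within real_spectrum A, continuous (restrict0 f)}.
Proof.
move=> cf; have [B0|B0] := pselect (real_spectrum B 0).
  have AB : real_spectrum A `<=` real_spectrum B.
    by move=> s; have [-> //|s0] := eqVneq s 0; exact: spectrum_swap.
  apply: within_eq (continuous_subspaceW AB cf) => s As.
  by rewrite restrict0_in//; exact: AB.
have [_ [c c0 hc]] := spectrum_gap B0.
move/subspace_continuousP: cf => cf; apply/subspace_continuousP => x Ax.
rewrite /from_subspace; apply/cvgrPdist_lt => e e0; apply/nbhs_ballP.
have [->|x0] := eqVneq x 0.
  exists c => //= y; rewrite /ball /= sub0r normrN => yc Ay.
  have [->|cy] := hc y Ay; first by rewrite subrr normr0.
  by move: yc; rewrite ltNge (le_trans cy (ler_norm y)).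
have Bx := spectrum_swap x0 Ax.
have /cvgrPdist_lt/(_ e e0)/nbhs_ballP[d /= d0 hd] := cf x Bx.
exists (Num.min d `|x|) => /=; first by rewrite lt_min d0 normr_gt0.
move=> y; rewrite /ball /= lt_min => /andP[yd yx] Ay.
have y0 : y != 0 by apply: contraTneq yx => ->; rewrite subr0 ltxx.
have By := spectrum_swap y0 Ay.
by rewrite !restrict0_in//; exact: hd.
Qed.

Variable Phi : (R -> R) -> H -> H.
Hypothesis calc : is_continuous_calculus A Phi.

(** [f(A)] commutes with [A] and [A V U = A], so the difference of the two arguments of [U] is in
    the kernel of [A], hence of [U]. This is what makes the transferred calculus multiplicative. *)
Lemma calc_initial_projection f u : {within real_spectrum A, continuous f} ->
  U (Phi f (V (U u))) = U (Phi f u).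
Proof.
move=> cf; have bf := calc_bounded calc cf.
apply/eqP; rewrite -subr_eq0 -(bopB _ _ bU) -(bopB _ _ bf); apply/eqP/ker_square.
have -> w : A (Phi f w) = Phi f (A w).
  by rewrite -(calc_id calc); apply: (calc_comm calc) => //; exact: within_id.
rewrite (bopB _ _ bA).
have -> : A (V (U u)) = A u by rewrite /A /= -!PP modulus_initial_projection.
by rewrite subrr (bop0 bf).
Qed.

(** [1 - U V] projects onto the kernel of [S], where [T S] vanishes and a function must act as its
    value at [0]. If [0] is outside the spectrum of [B], this summand is [0]. *)
Definition transfer_calculus f u :=
  U (Phi (restrict0 f) (V u)) + rs (restrict0 f 0) (u - U (V u)).

Lemma transfer_calculusP : is_continuous_calculus B transfer_calculus.
Proof.
have rD f g : restrict0 (fun s => f s + g s) = fun s => restrict0 f s + restrict0 g s.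
  by apply/funext => s; rewrite /restrict0; case: ifP => // _; rewrite addr0.
have rM f g : restrict0 (fun s => f s * g s) = fun s => restrict0 f s * restrict0 g s.
  by apply/funext => s; rewrite /restrict0; case: ifP => // _; rewrite mulr0.
have rZ r f : restrict0 (fun s => r * f s) = fun s => r * restrict0 f s.
  by apply/funext => s; rewrite /restrict0; case: ifP => // _; rewrite mulr0.
have rW := restrict0_within.
have bUV : bounded_operator (fun u => u - U (V u)).
  exact: bop_sub (@bop_id _ _) (bop_comp bU bV).
split.
- move=> f /rW/(calc_bounded calc) bf.
  exact: bop_add (bop_comp bU (bop_comp bf bV)) (bop_scale _ bUV).
- move=> f g _ _ fg; apply/funext => u; rewrite /transfer_calculus.
  suff -> : restrict0 f = restrict0 g by [].
  by apply/funext => s; rewrite /restrict0; case: asboolP => // /fg.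
- move=> f g /rW cf /rW cg; apply/funext => u.
  by rewrite /transfer_calculus rD (calc_add calc)// (bopD _ _ bU) rsDl addrACA.
- move=> r f /rW cf; apply/funext => u.
  by rewrite /transfer_calculus rZ (calc_scale calc)// (bopZ _ _ bU) rsM -rsD.
- move=> f g /rW cf /rW cg; apply/funext => u.
  have bf := calc_bounded calc cf; set w := transfer_calculus g u.
  set y := Phi (restrict0 g) (V u).
  (* [V] annihilates the [u - U (V u)] part of [w], so no cross term survives. *)
  have Vw : V w = V (U y).
    rewrite /w /transfer_calculus (bopD _ _ bV) (bopZ _ _ bV) (bopB _ _ bV).
    by rewrite adjoint_partial_isometryK subrr rs0r addr0.
  rewrite /= /transfer_calculus rM (calc_mul calc)// Vw calc_initial_projection//.
  rewrite partial_isometryK rsM; congr (_ + rs _ _).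
  by rewrite /w /transfer_calculus -/y [RHS]addrC addKr.
(* [restrict0] of the constant [1] may vanish at [0] on the spectrum of [A], but its product with
   the identity function is unchanged there; the resulting error lies in the kernel of [A], which
   [U] annihilates. *)
- have U1 u : U (Phi (restrict0 (fun=> 1)) u) = U u.
    have c1 := rW _ (@within_cst R _ 1).
    apply/eqP; rewrite -subr_eq0 -(bopB _ _ bU); apply/eqP/ker_square.
    rewrite (bopB _ _ bA) -(calc_id calc) -(calc_mul calc)//; last exact: within_id.
    rewrite (calc_ext calc (g := id)) ?subrr//.
    + by apply: (@within_mul _ _ id) => //; exact: within_id.
    + exact: within_id.
    + move=> s As; have [->|s0] := eqVneq s 0; first by rewrite mul0r.
      by rewrite restrict0_in ?mulr1//; exact: spectrum_swap.
  apply/funext => u; rewrite /transfer_calculus U1.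
  have [B0|B0] := pselect (real_spectrum B 0).
    by rewrite restrict0_in// rs1 addrC subrK.
  rewrite restrict0_out// rs0 addr0.
  have [[W [_ _ KW]] _] := spectrum_gap B0.
  by rewrite -(KW u) /B /= TE partial_isometryK.
- have -> : transfer_calculus id = fun u => U (A (V u)).
    apply/funext => u; rewrite /transfer_calculus.
    have -> : restrict0 id 0 = 0 by rewrite /restrict0; case: ifP.
    rewrite rs0 addr0 -(calc_id calc); congr (U _); congr (_ (V u)).
    apply: (calc_ext calc); [exact/rW/within_id|exact: within_id|move=> s As].
    have [->|s0] := eqVneq s 0; first by rewrite /restrict0; case: ifP.
    by rewrite restrict0_in//; exact: spectrum_swap.
  by apply/funext => u; rewrite /A /B /= -PP adjoint_polar TE.
- have [C hC] := calc_continuous calc.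
  have [KU KU0 hKU] := bop_bound bU; have [KV KV0 hKV] := bop_bound bV.
  have [KE KE0 hKE] := bop_bound bUV.
  exists (KU * (`|C| * KV) + KE) => f M /rW cf M0 fM u.
  have fM' s : `|restrict0 f s| <= M.
    by rewrite /restrict0; case: asboolP => [/fM//|_]; rewrite normr0.
  rewrite !mulrDl; apply: le_trans (hnorm_triangle _ _) _; apply: lerD.
    apply: le_trans (hKU _) _; rewrite -!mulrA; apply: ler_wpM2l; first exact: ltW.
    apply: le_trans (_ : `|C| * M * hnorm (V u) <= _).
      apply: le_trans (hC _ M cf M0 (fun s _ => fM' s) _) _.
      by do 2 (apply: ler_wpM2r; rewrite ?hnorm_ge0//); exact: ler_norm.
    have -> : `|C| * (KV * (M * hnorm u)) = `|C| * M * (KV * hnorm u) by ring.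
    by apply: ler_wpM2l; rewrite ?mulr_ge0.
  rewrite hnormZ -mulrA mulrCA; apply: ler_pM; rewrite ?hnorm_ge0//.
Qed.

End PolarTransfer.

(** * Default values of the encoding and the Aluthge transform *)

Section Aluthge.
Variables (R : realType) (H : rightQuatHilbertType R).
Implicit Types (u v : H) (s t : R) (T U X : H -> H).

Lemma adjoint_ip T u v : bounded_operator T -> ip (adjoint T u) v = ip u (T v).
Proof. by move=> bT; rewrite /ip (adjointP bT).2. Qed.

Lemma adjoint_unique T S : bounded_operator T ->
  (forall u v, ip (S u) v = ip u (T v)) -> adjoint T = S.
Proof.
by move=> bT aS; apply/funext => u; apply: ip_ext => v; rewrite adjoint_ip.
Qed.

Lemma fcalcP X : (exists Phi, is_continuous_calculus X Phi) ->
  is_continuous_calculus X (fcalc X).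
Proof.
by move=> ex; apply: (@xgetPex _ (fun _ _ => 0)
  [set Phi | is_continuous_calculus X Phi]).
Qed.

Lemma opow_none X t : ~ (exists Phi, is_continuous_calculus X Phi) ->
  opow X t = fun=> 0.
Proof.
move=> no; rewrite /opow /fcalc xgetPN// => Phi calc.
by apply: no; exists Phi.
Qed.

Lemma hyponormal_zero : hyponormal (fun _ : H => 0 : H).
Proof.
split=> [|u /=]; first exact: bop_zero.
have bA := (adjointP (@bop_zero R H)).1.
rewrite (bop0 bA) subrr; exists 0 => //.
by have := @innerZl R H 0 u 0; rewrite rscale0 => ->; congr Quat => /=; ring.
Qed.

End Aluthge.

Theorem theorem10 (R : realType) (H : rightQuatHilbertType R) (p : R)
  (T U : H -> H) (hp : 2^-1 <= p < 1) (hT : p_hyponormal p T)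
  (hU : polar_decomposition T U) : hyponormal (aluthge T U).
Proof.
have [bT pT] := hT; have [bU TE _ kerU] := hU.
have [bS _] := adjointP bT; have aS u v := adjoint_ip u v bT.
have [bV _] := adjointP bU; have aV u v := adjoint_ip u v bU.
set S := adjoint T in pT bS aS; set V := adjoint U in bV aV.
(* If a calculus were missing, the junk value [opow _ _ = 0] would make the
   transform vanish. *)
have [exP|noP] := pselect (exists Phi, is_continuous_calculus (absop T) Phi); last first.
  have -> : aluthge T U = fun=> 0 by rewrite /aluthge (opow_none _ noP).
  exact: hyponormal_zero.
have calcP := fcalcP exP.
have [exA|noA] := pselect (exists Phi, is_continuous_calculus (S \o T) Phi); last first.
  (* With [absop T = 0] the kernel condition gives [U = 0]; the outer factor maps [0] to [0] because
     [absop T] does have a calculus. *)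
  have P0 u : absop T u = 0 by rewrite /absop (opow_none _ noA).
  have -> : aluthge T U = fun=> 0.
    apply/funext => u; rewrite /aluthge /= kerU//; apply: bop0.
    apply: (pow_bounded calcP) => //.
    + by rewrite (_ : absop T = fun=> 0); [exact: bop_zero|exact/funext].
    + by move=> v w; rewrite !P0 ip0l ip0r.
    + by move=> v; rewrite P0 ip0l.
  exact: hyponormal_zero.
have calcA := fcalcP exA.
have bA : bounded_operator (S \o T) by exact: bop_comp.
have sA : symmetric_op (S \o T) by move=> u v /=; rewrite aS ipC -aS ipC.
have nA : nonneg_op (S \o T) by move=> u /=; rewrite aS ip_ge0.
have bB : bounded_operator (T \o S) by exact: bop_comp.
have sB : symmetric_op (T \o S) by move=> u v /=; rewrite ipC -aS ipC aS.
have nB : nonneg_op (T \o S) by move=> u /=; rewrite ipC -aS ip_ge0.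
have h0 : 0 < 2^-1 :> R by rewrite invr_gt0.
have h1 : 2^-1 <= 1 :> R by rewrite invf_le1// ler1n.
have h01 : 0 < (2^-1 : R) <= 1 by rewrite h0 h1.
set P := absop T in TE kerU exP calcP *.
have bP : bounded_operator P by exact: (pow_bounded calcA bA sA nA (ltW h0)).
have sP : symmetric_op P by exact: (pow_symmetric calcA bA sA nA h01).
have nP : nonneg_op P by exact: (pow_nonneg calcA bA sA nA h01).
have PP u : P (P u) = S (T u) by exact: (pow_sqrtK calcA bA sA nA).
have TEu u : T u = U (P u) by rewrite {1}TE.
have exB := ex_intro (is_continuous_calculus (T \o S)) _
  (transfer_calculusP bT bS bU bV bP sP aS aV TEu PP kerU calcA).
have calcB := fcalcP exB.
have VUP := initial_projection_modulus bP sP aS aV TEu PP kerU.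
have PVU := modulus_initial_projection bP sP aS aV TEu PP kerU.
have SE := adjoint_polar sP aS aV TEu.
pose C u := U (P (V u)).
have bC : bounded_operator C by exact: bop_comp bU (bop_comp bP bV).
have sC : symmetric_op C by move=> u v; rewrite /C ipC -!aV ipC sP.
have CC u : C (C u) = T (S u) by rewrite /C VUP TEu SE.
have CP u : ip (C u) u <= ip (P u) u.
  have le_p u' : ip (calc_pow (fcalc (T \o S)) p u') u' <= ip (calc_pow (fcalc (S \o T)) p u') u'.
    by rewrite -subr_ge0 -ipNl -ipDl; exact: (positive_nonneg pT).
  have /andP[p1 p2] := hp; have p0 : 0 < p <= 1 by rewrite (lt_le_trans h0 p1) (ltW p2).
  have ph : p / 2 <= 2^-1 <= p by rewrite p1 andbT; lra.
  apply: le_trans (loewner_heinz calcA calcB bA sA nA bB sB nB p0 ph le_p u).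
  set X := calc_pow _ _.
  have bX : bounded_operator X by exact: (pow_bounded calcB bB sB nB (ltW h0)).
  have sX : symmetric_op X by exact: (pow_symmetric calcB bB sB nB h01).
  have nX : nonneg_op X by exact: (pow_nonneg calcB bB sB nB h01).
  have XX v : X (X v) = T (S v) by exact: (pow_sqrtK calcB bB sB nB).
  rewrite ipC [leRHS]ipC.
  (* [C] and [X] are both square roots of [T S], so [|C v| = |X v|]; monotonicity of the square root
     gives [C <= X] without appeal to uniqueness of positive square roots. *)
  apply: (geometric_mean_le (@bop_id R H) bC (@bop_id R H) bX) => //.
  + exact: ip_ge0.
  + by move=> v; rewrite ipC; exact: nX.
  + by move=> v; rewrite -sC CC sX XX ipC.
  + move=> e e0; exists (rs (1 + e)^-1) => v.
    by rewrite -[X in X + _]rs1 -rsDl -rsM divff ?rs1// lt0r_neq0// addr_gt0.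
have bQ : bounded_operator (opow P 2^-1) by exact: (pow_bounded calcP bP sP nP (ltW h0)).
have sQ : symmetric_op (opow P 2^-1) by exact: (pow_symmetric calcP bP sP nP h01).
have QQ u : opow P 2^-1 (opow P 2^-1 u) = P u by exact: (pow_sqrtK calcP bP sP nP).
rewrite /aluthge -/P; set Q := opow P 2^-1 in bQ sQ QQ *.
have bt : bounded_operator (Q \o U \o Q) by exact: bop_comp (bop_comp bQ bU) bQ.
have att' u v : ip ((Q \o V \o Q) u) v = ip u ((Q \o U \o Q) v) by rewrite /= sQ aV sQ.
split=> //; rewrite (adjoint_unique bt att').
have bt' : bounded_operator (Q \o V \o Q) by exact: bop_comp (bop_comp bQ bV) bQ.
(* At [w = Q u] the outer terms of [lower] and [upper] are the squared norms of [t' u] and [t u],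
   and [ip (P w) w] separates them. *)
have lower w : ip (Q (V w)) (Q (V w)) <= ip (P w) w.
  by rewrite sQ QQ aV ipC; exact: CP.
have upper w : ip (P w) w <= ip (Q (U w)) (Q (U w)).
  rewrite sQ QQ; apply: le_trans (_ : ip (C (U w)) (U w) <= _).
    by rewrite /C PVU -aV VUP.
  by rewrite [leRHS]ipC; exact: CP.
set t := Q \o U \o Q in bt att' *; set t' := Q \o V \o Q in bt' att' *.
have t'E u v : ip (t u) v = ip u (t' v) by rewrite ipC -att' ipC.
apply: positive_symmetric.
- by apply: bop_sub; apply: bop_comp.
- by move=> u v; rewrite /= !ipE !(att', t'E).
- move=> u; rewrite /= ipDl ipNl att' [ip (t (t' u)) u]t'E subr_ge0.
  exact: le_trans (lower _) (upper _).
Qed.
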